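(* Let $G=(\mathcal{V},\mathcal{E})$ be a finite simple graph with $|\mathcal{E}|\ge1$ which is $k$-degenerate. Then for every $d>k$ and every compact set $E\subset\mathbb{R}^d$ with $\dim(E)>\frac{d+k}{2}$, the $|\mathcal{E}|$-dimensional Lebesgue measure of $\Delta^{G}(E)$ is positive.
   Context: A graph $G$ is $k$-degenerate if $k$ is the least number such that every induced subgraph of $G$ contains a vertex with at most $k$ neighbors (in that subgraph). With $\mathcal{V}=\{v_1,\dots,v_{|\mathcal{V}|}\}$ and edges written $(v_i,v_j)$ with $i<j$, the $G$-distance set of $E$ is $\Delta^{G}(E)=\{(|x_i-x_j|)_{(v_i,v_j)\in\mathcal{E}} : x_1,\dots,x_{|\mathcal{V}|}\in E\}\subset\mathbb{R}^{|\mathcal{E}|}$. $\dim$ denotes Hausdorff dimension. *)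

(* Defs.v *)
From HB Require Import structures.
From mathcomp Require Import all_boot all_order all_algebra.
From mathcomp Require Import all_classical all_reals all_analysis.
Set Implicit Arguments. Unset Strict Implicit. Unset Printing Implicit Defensive.
Import Order.TTheory GRing.Theory Num.Theory.
Import numFieldNormedType.Exports.
Local Open Scope classical_set_scope.
Local Open Scope ring_scope.

Definition enorm (R : realType) (d : nat) (x : 'rV[R]_d) : R :=
  Num.sqrt (\sum_(i < d) x ord0 i ^+ 2).

Definition edist (R : realType) (d : nat) (x y : 'rV[R]_d) : R := enorm (x - y).

(* Euclidean diameter of a set (extended real; -oo for the empty set). *)
Definition ediam (R : realType) (d : nat) (A : set 'rV[R]_d) : \bar R :=
  ereal_sup [set (edist x y)%:E | x in A & y in A].

Definition hcov_term (R : realType) (d : nat) (s : R) (U : set 'rV[R]_d) : \bar R :=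
  if asbool (U = set0) then 0%E else (powR (fine (ediam U)) s)%:E.

Definition hausdorff_content_delta (R : realType) (d : nat) (s delta : R)
    (E : set 'rV[R]_d) : \bar R :=
  ereal_inf [set (\sum_(0 <= i <oo) hcov_term s (U i))%E |
              U in [set U : nat -> set 'rV[R]_d |
                      E `<=` \bigcup_i U i /\ forall i, (ediam (U i) <= delta%:E)%E]].

(* H^s(E) = lim_{delta -> 0+} H^s_delta(E) = sup_{delta > 0} H^s_delta(E) *)
Definition hausdorff_measure (R : realType) (d : nat) (s : R) (E : set 'rV[R]_d)
    : \bar R :=
  ereal_sup [set hausdorff_content_delta s delta E | delta in [set delta : R | 0 < delta]].

Definition hausdorff_dim (R : realType) (d : nat) (E : set 'rV[R]_d) : R :=
  inf [set s : R | 0 <= s /\ hausdorff_measure s E = 0%E].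

Definition box (R : realType) (I : finType) (a b : I -> R) : set (I -> R) :=
  [set x | forall i, a i <= x i <= b i].

Definition lebesgue_outer (R : realType) (I : finType) (A : set (I -> R)) : \bar R :=
  ereal_inf [set (\sum_(0 <= j <oo) (\prod_(i : I) ((ab j).2 i - (ab j).1 i))%:E)%E |
              ab in [set ab : nat -> (I -> R) * (I -> R) |
                      (forall j i, (ab j).1 i <= (ab j).2 i) /\
                      A `<=` \bigcup_j box (ab j).1 (ab j).2]].

Definition simple_graph (n : nat) (e : rel 'I_n) : Prop :=
  symmetric e /\ irreflexive e.

Definition edge_of (n : nat) (e : rel 'I_n) (p : 'I_n * 'I_n) : bool :=
  (p.1 < p.2)%N && e p.1 p.2.

Definition edge_type (n : nat) (e : rel 'I_n) : finType :=
  {p : 'I_n * 'I_n | edge_of e p}.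

Definition degenerate_le (n : nat) (e : rel 'I_n) (k : nat) : Prop :=
  forall S : {set 'I_n}, S != finset.set0 ->
    exists2 v, v \in S & (#|[set u in S | e v u]| <= k)%N.

Definition k_degenerate (n : nat) (e : rel 'I_n) (k : nat) : Prop :=
  degenerate_le e k /\ forall k', degenerate_le e k' -> (k <= k')%N.

Definition distance_set (R : realType) (d n : nat) (e : rel 'I_n)
    (E : set 'rV[R]_d) : set (edge_type e -> R) :=
  [set f | exists x : 'I_n -> 'rV[R]_d, (forall v, E (x v)) /\
           forall p : edge_type e, f p = edist (x (val p).1) (x (val p).2)].

Arguments distance_set {R d n} e E.

(* Main.v *)
(* Discretize E at scale 2 ^ -m: a greedy Frostman construction gives a probability mu
   on the dyadic cells meeting E such that cells of level j have mass O(q ^ j), where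
   q = 2 ^ -s and 2 ^ (d + k) q ^ 2 < 1. An elementary large sieve inequality on the
   grid shows that, for y_1, ..., y_k chosen independently with law mu, the distribution
   of the k distances from a mu-random point to the y_u has on average squared L2 norm
   O(2 ^ (- m k)) at resolution 2 ^ -m, as for a bounded density on R^k. Adding the
   vertices of G one at a time, each with at most k earlier neighbours, shows that the
   distance vector of a mu-random configuration charges sets of few grid boxes only
   with small probability. If the distance set were null, compactness would put all
   distance vectors into such a set of boxes. *)
Require Import Defs.
From HB Require Import structures.
From mathcomp Require Import all_boot all_order all_algebra.
From mathcomp Require Import all_classical all_reals all_analysis.
From mathcomp Require Import complex.
From mathcomp Require Import ring lra zify.
Set Implicit Arguments. Unset Strict Implicit. Unset Printing Implicit Defensive.
Import Order.TTheory GRing.Theory Num.Theory.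
Import numFieldNormedType.Exports.
(* Reimported so that edist is the Euclidean distance of Defs, not the extended
   distance of mathcomp-analysis. *)
Import Defs.
Local Open Scope classical_set_scope.
Local Open Scope ring_scope.

(** The threshold (d + k) / 2 comes from one geometric series. At frequency scale 2 ^ j the large
    sieve contributes 2 ^ (j d) q ^ (2 j), and the pairs of frequencies differing by at most that
    scale outnumber the coinciding ones by a factor of order 2 ^ (j k); the sum over j is bounded
    uniformly in m because 2 ^ (d + k) q ^ 2 < 1. The phases use squared distances because |x - y|^2
    = |x|^2 + |y|^2 - 2 x.y: once factors in x or y alone are absorbed, a character of x.y remains.
    Individual pins y_u may be bad, so only the average over random pins is controlled; this
    suffices because in a random configuration the earlier neighbours of a vertex are themselves
    independent with law mu. No limit measure is formed: all constants are uniform in m, so the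
    cover of the distance set is fixed first and the resolution chosen afterwards. *)

Section FiniteSums.
Variable C : numFieldType.

Lemma sqr_sum_le (I : finType) (f : I -> C) : (forall i, f i \is Num.real) ->
  (\sum_i f i) ^+ 2 <= #|I|%:R * \sum_i f i ^+ 2.
Proof.
move=> fr.
have : 0 <= \sum_i \sum_j (f i - f j) ^+ 2.
  by apply: sumr_ge0 => i _; apply: sumr_ge0 => j _; rewrite real_exprn_even_ge0// realB.
have -> : \sum_i \sum_j (f i - f j) ^+ 2
    = (#|I|%:R * \sum_i f i ^+ 2 - (\sum_i f i) ^+ 2) *+ 2.
  transitivity (\sum_i (#|I|%:R * f i ^+ 2 + \sum_j f j ^+ 2 - f i * (\sum_j f j) *+ 2)).
    apply: eq_bigr => i _.
    rewrite mulr_sumr -sumrMnl.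
    rewrite mulr_natl -sumr_const -big_split/= -sumrB.
    by apply: eq_bigr => j _; ring.
  rewrite sumrB big_split/= -mulr_sumr sumr_const -mulr_natl sumrMnl -mulr_suml.
  ring.
by rewrite pmulrn_lge0// subr_ge0.
Qed.

Lemma ler_sum_inj (I J : finType) (h : I -> J) (f : J -> C) :
  injective h -> (forall j, 0 <= f j) -> \sum_i f (h i) <= \sum_j f j.
Proof.
move=> hi f0.
rewrite (partition_big h xpredT)//=; apply: ler_sum => j _.
case: (pickP (fun i => h i == j)) => [i /eqP ij|nij].
  rewrite (bigD1 i) ?ij//= big1 ?addr0// => k /andP[/eqP kj].
  by rewrite (hi k i) ?eqxx// kj.
by rewrite big1// => i; rewrite nij.
Qed.

Lemma ler_sum_cover (I J : finType) (P : pred I) (Q : J -> pred I) (f : I -> C) :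
  (forall i, 0 <= f i) -> (forall i, P i -> exists j, Q j i) ->
  \sum_(i | P i) f i <= \sum_j \sum_(i | Q j i) f i.
Proof.
move=> f0 PQ.
under [leRHS]eq_bigr do rewrite big_mkcond.
rewrite exchange_big/= big_mkcond; apply: ler_sum => i _.
case: ifP => Pi; last by apply: sumr_ge0 => j _; case: ifP.
have [j Qji] := PQ _ Pi.
by rewrite (bigD1 j)//= Qji lerDl; apply: sumr_ge0 => k _; case: ifP.
Qed.

Lemma ler_sum_sub (I : finType) (P Q : pred I) (f : I -> C) :
  (forall i, 0 <= f i) -> (forall i, P i -> Q i) ->
  \sum_(i | P i) f i <= \sum_(i | Q i) f i.
Proof.
move=> f0 PQ; rewrite big_mkcond [leRHS]big_mkcond; apply: ler_sum => i _.
by case: ifP => Pi; [rewrite PQ|case: ifP].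
Qed.

End FiniteSums.

(** * Large sieve inequality on the grid *)

(* G(y) = sum_x mu x g x w ^ (x . y) has frequencies
   bounded by the inverse of S, hence is essentially constant on cells of side S:
   dividing g by the Fejer-type average phi exhibits G as an average of a similar
   sum over shifts by less than S. Summing over all y instead of against mu then
   costs a factor B, and orthogonality finishes. *)
Section LargeSieve.
Variables (C : numClosedFieldType) (d : nat).

Lemma norm_sqr_sum_le (I : finType) (f : I -> C) :
  `|\sum_i f i| ^+ 2 <= #|I|%:R * \sum_i `|f i| ^+ 2.
Proof.
apply: le_trans (sqr_sum_le _) => [|i]; last exact: normr_real.
by rewrite lerXn2r ?nnegrE ?sumr_ge0// ler_norm_sum.
Qed.

Lemma norm_geometric_sum (u : C) n : `|u| = 1 -> `|u - 1| * `|\sum_(i < n) u ^+ i| <= 2.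
Proof.
move=> u1; rewrite -normrM -subrX1 (le_trans (ler_normB _ _))//.
by rewrite normrX u1 expr1n normr1.
Qed.

Lemma norm_geometric_sum_le (u : C) n : `|u| = 1 -> `|\sum_(i < n) u ^+ i| <= n%:R.
Proof.
move=> u1; rewrite (le_trans (ler_norm_sum _ _ _))//.
under eq_bigr do rewrite normrX u1 expr1n.
by rewrite sumr_const card_ord.
Qed.

Definition addff m n (y : {ffun 'I_d -> 'I_m}) (z : {ffun 'I_d -> 'I_n}) :
    {ffun 'I_d -> 'I_(m + n)} :=
  [ffun i => Ordinal (leq_add (ltn_ord (y i)) (ltnW (ltn_ord (z i))))].

Lemma addffE m n (y : {ffun 'I_d -> 'I_m}) (z : {ffun 'I_d -> 'I_n}) i :
  addff y z i = (y i + z i)%N :> nat.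
Proof. by rewrite ffunE. Qed.

Lemma addff_injl m n (z : {ffun 'I_d -> 'I_n}) : injective (fun y : {ffun 'I_d -> 'I_m} => addff y z).
Proof.
move=> y y' /ffunP E; apply/ffunP => i; apply/val_inj => /=.
have := congr1 (@nat_of_ord _) (E i); rewrite !addffE; apply: addIn.
Qed.

Variables (M S kap : nat) (mu : {ffun 'I_d -> 'I_M} -> C) (B : C) (w : C).
Hypothesis S0 : (0 < S)%N.
Hypothesis SM : (S <= M)%N.
Hypothesis kap0 : (0 < kap)%N.
Hypothesis mu0 : forall x, 0 <= mu x.
Hypothesis mu1 : \sum_x mu x <= 1.
Hypothesis muB : forall c : 'I_d -> nat, \sum_(x : {ffun 'I_d -> 'I_M} | [forall i, x i %/ S == c i]%N) mu x <= B.
Hypothesis w1 : `|w| = 1.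
Hypothesis wRe : forall n, (n <= M * S)%N -> 2^-1 <= 'Re (w ^+ n).
Hypothesis wsub : forall v, (v < M)%N -> v%:R / (4 * kap * M * S)%:R <= `|w ^+ v - 1|.

Local Notation X := {ffun 'I_d -> 'I_M}.

Let B0 : 0 <= B.
Proof. by apply: le_trans (muB (fun=> 0%N)); apply: sumr_ge0. Qed.

(** A given z is reached only from y with y_i <= z_i < y_i + S. In each coordinate [y i %/ S] is
    then [z i %/ S] or its predecessor, so these y lie in at most 2 ^ d cells, each of mass at most
    B. *)
Lemma sum_mu_shift (F : {ffun 'I_d -> 'I_(M + S)} -> C) : (forall z, 0 <= F z) ->
  \sum_y mu y * (\sum_(a : {ffun 'I_d -> 'I_S}) F (addff y a))
    <= 2 ^+ d * B * \sum_z F z.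
Proof.
move=> F0.
under eq_bigr do rewrite mulr_sumr.
rewrite pair_bigA/= (partition_big (fun p => addff p.1 p.2) xpredT)//=.
rewrite mulr_sumr; apply: ler_sum => z _.
apply: (@le_trans _ _ (\sum_(p : X * {ffun 'I_d -> 'I_S} | addff p.1 p.2 == z) mu p.1 * F z)).
  by apply: ler_sum => p /eqP ->.
rewrite -mulr_suml ler_wpM2r//.
pose Q (b : {ffun 'I_d -> bool}) (y : X) := [forall i, y i %/ S == z i %/ S - b i]%N.
apply: (@le_trans _ _ (\sum_(b : {ffun 'I_d -> bool}) \sum_(y | Q b y) mu y)).
  apply: (@le_trans _ _ (\sum_(y : X | [forall i, (y i <= z i < y i + S)%N]) mu y)).
    rewrite big_mkcond/= -(pair_bigA _ (fun y a => if addff y a == z then mu y else 0))/=.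
    rewrite [leRHS]big_mkcond; apply: ler_sum => y _.
    rewrite -big_mkcond.
    case: (pickP (fun a : {ffun 'I_d -> 'I_S} => addff y a == z)) => [a az|noa].
      rewrite (bigD1 a)//= big1 ?addr0.
        case: ifP => // /negP[]; apply/forallP => i.
        move/eqP: az => <-; rewrite addffE leq_addr/= ltn_add2l; exact: ltn_ord.
      move=> a' /andP[a'z]; rewrite -(eqP az) in a'z; case/eqP.
      apply/ffunP => i; apply/val_inj => /=.
      have := congr1 (fun f : {ffun 'I_d -> 'I_(M + S)} => nat_of_ord (f i)) (eqP a'z).
      rewrite !addffE; apply: addnI.
    by rewrite big1 => [|a]; [case: ifP|rewrite noa].
  apply: ler_sum_cover => // y /forallP yz.
  exists [ffun i => (y i %/ S != z i %/ S)%N]; apply/forallP => i; rewrite ffunE.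
  have /andP[y1 y2] := yz i.
  have h1 : (y i %/ S <= z i %/ S)%N by apply: leq_div2r.
  have h2 : (z i %/ S <= (y i %/ S).+1)%N.
    have <- : ((y i + S) %/ S = (y i %/ S).+1)%N by rewrite divnDr// divnn S0 addn1.
    by apply: leq_div2r; exact: ltnW.
  move: h1 h2; move: (y i %/ S)%N (z i %/ S)%N => u v h1 h2.
  case: (eqVneq u v) => [->|ne] /=; first by rewrite subn0.
  by apply/eqP; move/eqP: ne; lia.
rewrite -[2]/(2%:R) -natrX (_ : (2 ^ d)%N = #|{: {ffun 'I_d -> bool}}|); last first.
  by rewrite card_ffun card_bool card_ord.
rewrite mulr_natl -sumr_const; apply: ler_sum => b _; exact: muB.
Qed.

Let phi n := \sum_(a < S) w ^+ (n * a).

Let phi_ge n : (n < M)%N -> S%:R / 2 <= `|phi n|.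
Proof.
move=> nM; apply: le_trans (_ : 'Re (phi n) <= _); last first.
  exact: (leif_Re_Creal _).1.
rewrite raddf_sum/= -[S in S%:R]card_ord mulr_natl -sumr_const.
by apply: ler_sum => a _; apply: wRe; rewrite leq_mul// ltnW.
Qed.

Let chi (z : 'I_d -> nat) (x : X) := \prod_i w ^+ (x i * z i).

Lemma sum_chi_shift (g : X -> C) : (forall x, `|g x| <= 1) ->
  exists h : X -> C, (forall x, `|h x| <= (2 / S%:R) ^+ d) /\
   forall y : X, \sum_x mu x * g x * chi (fun i => y i) x =
     \sum_(a : {ffun 'I_d -> 'I_S}) \sum_x mu x * h x * chi (fun i => addff y a i) x.
Proof.
move=> g1; exists (fun x => g x / \prod_i phi (x i)).
have S0C : 0 < S%:R / 2 :> C by rewrite divr_gt0// ltr0n.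
have phi0 n : (n < M)%N -> phi n != 0.
  by move=> nM; rewrite -normr_gt0 (lt_le_trans _ (phi_ge nM)).
split=> [x|y].
  rewrite normrM normfV normr_prod -[leRHS]mul1r ler_pM ?invr_ge0 ?prodr_ge0//.
  rewrite -[2 / _]invf_div exprVn lef_pV2 ?posrE ?exprn_gt0 ?prodr_gt0//; last first.
    by move=> i _; rewrite normr_gt0 phi0.
  rewrite -[d in _ ^+ d]card_ord -prodr_const; apply: ler_prod => i _.
  by rewrite (ltW S0C) phi_ge.
rewrite exchange_big/=; apply: eq_bigr => x _.
rewrite -mulr_sumr -!mulrA; congr (_ * (_ * _)).
have -> : \sum_(a : {ffun 'I_d -> 'I_S}) chi (fun i => addff y a i) x = chi (fun i => y i) x * \prod_i phi (x i).
  rewrite /phi bigA_distr_bigA/= mulr_sumr; apply: eq_bigr => a _.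
  rewrite -big_split/=; apply: eq_bigr => i _.
  by rewrite addffE mulnDr exprD.
by rewrite mulrC mulfK//; apply/prodf_neq0 => i _; rewrite phi0.
Qed.

Let u (a b : nat) := w ^+ a * (w^*) ^+ b.

Let wwC : w * w^* = 1. Proof. by rewrite -normCK w1 expr1n. Qed.

Let normu a b : `|u a b| = 1.
Proof. by rewrite normrM !normrX norm_conjC w1 !expr1n mulr1. Qed.

Let normu1 a b : `|u a b - 1| = `|w ^+ ((a - b) + (b - a)) - 1|.
Proof.
have [ba|ab] := leqP b a.
  rewrite (eqP ba : (b - a)%N = 0%N) addn0 /u -{1}(subnK ba) exprD -mulrA -exprMn.
  by rewrite wwC expr1n mulr1.
rewrite (eqP (ltnW ab)) add0n /u -{1}(subnK (ltnW ab)) exprD mulrCA -exprMn wwC expr1n mulr1.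
by rewrite -norm_conjC rmorphB rmorphXn/= conjCK rmorph1.
Qed.

Let D n a b := \sum_(c < n) u a b ^+ c.

(** At cell distance at most 1 the trivial bound n <= 4 M suffices. Beyond that |a - b| >= (dl + 1)
    S / 3 and the geometric sum is at most 2 / |w ^ |a - b| - 1|; hence 24 = 3 * 2 * 4. *)
Let D_le n a b : (n <= 4 * M)%N -> (a < M)%N -> (b < M)%N ->
  `|D n a b| <= (24 * kap * M)%:R / ((a %/ S - b %/ S) + (b %/ S - a %/ S)).+1%:R.
Proof.
move=> nM aM bM; set dl := (_ + _)%N.
have M0 : (0 < M)%N by apply: leq_trans S0 SM.
rewrite ler_pdivlMr ?ltr0n//.
have [dl1|dl2] := leqP dl 1.
  apply: le_trans (_ : n%:R * 2%:R <= _).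
    by rewrite ler_pM ?norm_geometric_sum_le ?ler_nat.
  by rewrite -natrM ler_nat; nia.
set v := ((a - b) + (b - a))%N.
have vM : (v < M)%N by rewrite /v; lia.
have vdl : (dl.+1 * S <= 3 * v)%N.
  have := divn_eq a S; have := divn_eq b S.
  have := ltn_pmod a S0; have := ltn_pmod b S0.
  move: dl2; rewrite /dl /v; move: (a %/ S)%N (a %% S)%N (b %/ S)%N (b %% S)%N => q r q' r'.
  move=> dl2 r'S rS -> ->.
  have [qq|qq] := leqP q q'.
    have [t qt] : exists t, q' = (q + t)%N by exists (q' - q)%N; lia.
    subst q'; have -> : (q - (q + t) + (q + t - q) = t)%N by lia.
    have t2 : (2 <= t)%N by lia.
    have : (2 * S <= t * S)%N by rewrite leq_mul2r t2 orbT.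
    by rewrite mulnDl (mulSn t); move: (t * S)%N (q * S)%N; lia.
  have [t qt] : exists t, q = (q' + t)%N by exists (q - q')%N; lia.
  subst q; have -> : (q' + t - q' + (q' - (q' + t)) = t)%N by lia.
  have t2 : (2 <= t)%N by lia.
  have : (2 * S <= t * S)%N by rewrite leq_mul2r t2 orbT.
  by rewrite mulnDl (mulSn t); move: (t * S)%N (q' * S)%N; lia.
have v0 : (0 < v)%N by nia.
have := norm_geometric_sum n (normu a b); rewrite normu1 -/v => Dle.
have P0 : 0 < (4 * kap * M * S)%:R :> C by rewrite ltr0n !muln_gt0 kap0 M0 S0.
have vD : v%:R * `|D n a b| <= 2 * (4 * kap * M * S)%:R.
  apply: le_trans (_ : `|w ^+ v - 1| * (4 * kap * M * S)%:R * `|D n a b| <= _).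
    by rewrite ler_wpM2r// -ler_pdivrMr// wsub.
  by rewrite mulrAC ler_wpM2r// ltW.
have S0C : 0 < S%:R :> C by rewrite ltr0n.
rewrite -(ler_pM2r S0C) -mulrA -natrM.
apply: le_trans (_ : 3 * (v%:R * `|D n a b|) <= _).
  by rewrite mulrA mulrC -[3]/(3%:R) -natrM ler_wpM2r// ler_nat.
apply: le_trans (ler_wpM2l _ vD) _ => //.
by rewrite -[3]/(3%:R) -[2]/(2%:R) -!natrM ler_nat; lia.
Qed.

(** A single Dirichlet kernel decays like the inverse of the cell distance, which is not summable.
    Writing each z as c - c' in l ^ d ways, with c below n + l and c' below l, turns the kernel into
    a product of two Dirichlet kernels, whose squared decay is summable. *)
Lemma sum_sqr_chi_le (al : X -> C) n l : (n + l <= 4 * M)%N ->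
  (\sum_(z : {ffun 'I_d -> 'I_n}) `|\sum_x al x * chi (fun i => z i) x| ^+ 2) * (l ^ d)%:R
  <= \sum_x \sum_y `|al x| * `|al y| *
     \prod_i ((24 * kap * M)%:R / ((x i %/ S - y i %/ S) + (y i %/ S - x i %/ S)).+1%:R) ^+ 2.
Proof.
move=> nlM.
pose psi (c c' : 'I_d -> nat) (x : X) := \prod_i (w ^+ (x i * c i) * (w^*) ^+ (x i * c' i)).
apply: le_trans (_ : \sum_(c : {ffun 'I_d -> 'I_(n + l)}) \sum_(c' : {ffun 'I_d -> 'I_l})
    `|\sum_x al x * psi (fun i => c i) (fun i => c' i) x| ^+ 2 <= _).
  rewrite exchange_big/= mulrC mulr_natl.
  have -> : (l ^ d)%N = #|{: {ffun 'I_d -> 'I_l}}| by rewrite card_ffun !card_ord.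
  rewrite -sumr_const; apply: ler_sum => c' _.
  apply: le_trans (_ : _ <= \sum_(z : {ffun 'I_d -> 'I_n})
    `|\sum_x al x * psi (fun i => addff z c' i) (fun i => c' i) x| ^+ 2) _.
    apply: ler_sum => z _; rewrite le_eqVlt; apply/orP; left; apply/eqP.
    congr (`|_| ^+ 2); apply: eq_bigr => x _; congr (_ * _); apply: eq_bigr => i _.
    rewrite addffE mulnDr exprD -mulrA -exprMn wwC expr1n mulr1//.
  pose f (c : {ffun 'I_d -> 'I_(n + l)}) :=
    `|\sum_x al x * psi (fun i => c i) (fun i => c' i) x| ^+ 2.
  by apply: (@ler_sum_inj C _ _ _ f (@addff_injl n l c')) => c; rewrite exprn_ge0.
set T := leLHS.
have TE : T = \sum_x \sum_y al x * (al y)^* *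
    ((\prod_i D (n + l) (x i) (y i)) * (\prod_i (D l (x i) (y i))^*)).
  rewrite /T; under eq_bigr do under eq_bigr do rewrite normCK rmorph_sum/= big_distrlr/=.
  under eq_bigr do rewrite exchange_big/=.
  rewrite exchange_big/=; apply: eq_bigr => x _.
  under eq_bigr do rewrite exchange_big/=.
  rewrite exchange_big/=; apply: eq_bigr => y _.
  rewrite /D; under [X in _ * (_ * X)]eq_bigr do rewrite rmorph_sum/=.
  rewrite !bigA_distr_bigA/= big_distrlr/= mulr_sumr.
  apply: eq_bigr => c _; rewrite mulr_sumr; apply: eq_bigr => c' _.
  rewrite rmorphM mulrACA; congr (_ * _).
  rewrite rmorph_prod -!big_split/=; apply: eq_bigr => i _.
  rewrite rmorphM !rmorphXn/= conjCK rmorphM/= !rmorphXn/= conjCK !exprMn -!exprM.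
  by rewrite mulrACA [X in _ * X]mulrC; congr (_ * _); ring.
have T0 : 0 <= T by apply: sumr_ge0 => c _; apply: sumr_ge0 => c' _; rewrite exprn_ge0.
rewrite -(ger0_norm T0) TE (le_trans (ler_norm_sum _ _ _))//; apply: ler_sum => x _.
rewrite (le_trans (ler_norm_sum _ _ _))//; apply: ler_sum => y _.
rewrite !normrM norm_conjC ler_wpM2l ?mulr_ge0// !normr_prod -big_split/=.
apply: ler_prod => i _; rewrite norm_conjC mulr_ge0//= expr2 ler_pM// D_le//; lia.
Qed.

Let wt a b : C := ((a - b) + (b - a)).+1%:R ^- 2.

Lemma inv_sqr_le n : n.+2%:R ^- 2 <= n.+1%:R^-1 - n.+2%:R^-1 :> C.
Proof.
have n1 : n.+1%:R != 0 :> C by rewrite pnatr_eq0.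
have n2 : n.+2%:R != 0 :> C by rewrite pnatr_eq0.
have -> : n.+1%:R^-1 - n.+2%:R^-1 = (n.+1%:R * n.+2%:R)^-1 :> C.
  by move: n1 n2; rewrite -(@natr1 _ n.+1); move: n.+1%:R => a a0 a1; field; rewrite a0 a1.
by rewrite expr2 lef_pV2 ?posrE ?mulr_gt0 ?ltr0n// ler_wpM2r// ler_nat.
Qed.

(** The two branches are the telescoped sums before and after passing a; in this form the induction
    closes, and the bound never exceeds 3. *)
Let sum_wt_le a n : \sum_(b < n) wt a b <=
  if (n <= a)%N then (a - n).+1%:R^-1 else 3 - (n - a)%:R^-1.
Proof.
elim: n => [|n IH]; first by rewrite big_ord0 leq0n subn0 invr_ge0.
rewrite big_ord_recr/=; have [na|an] := ltnP n a.
  rewrite (ltnW na) in IH; rewrite -(subnSK na) in IH.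
  apply: le_trans (lerD IH (_ : _ <= (a - n.+1).+1%:R^-1 - (a - n.+1).+2%:R^-1)) _.
    by rewrite /wt (eqP (ltnW na)) addn0 -(subnSK na) inv_sqr_le.
  by rewrite addrC subrK.
have [e|ne] := eqVneq n a.
  rewrite -{}e leqnn subnn invr1 in IH *; rewrite subSnn invr1 /wt subnn/= expr1n invr1.
  by apply: le_trans (lerD IH (lexx _)) _; rewrite -(natrD _ 1 1) -(natrB _ (isT : 1 <= 3)%N).
have an' : (a < n)%N by rewrite ltn_neqAle eq_sym ne.
rewrite leqNgt an'/= in IH.
apply: le_trans (lerD IH (_ : _ <= (n - a)%:R^-1 - (n - a).+1%:R^-1)) _.
  rewrite /wt (eqP an) add0n -(subnSK an'); exact: inv_sqr_le.
by rewrite subSn// addrA subrK.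
Qed.

Let sum_cells_le x : \sum_y mu y * \prod_i wt (x i %/ S) (y i %/ S) <= 4 ^+ d * B.
Proof.
have wt0 a b : 0 <= wt a b by rewrite invr_ge0 exprn_ge0.
have cellP (y : X) i : (y i %/ S < M)%N by rewrite (leq_ltn_trans (leq_div _ _)).
pose cell (y : X) : X := [ffun i => Ordinal (cellP y i)].
rewrite (partition_big cell xpredT)//=.
apply: le_trans (_ : \sum_(c : X) (\prod_i wt (x i %/ S) (c i)) * B <= _).
  apply: ler_sum => c _.
  apply: le_trans (_ : \sum_(y | cell y == c) (\prod_i wt (x i %/ S) (c i)) * mu y <= _).
    apply: ler_sum => y /eqP <-; rewrite mulrC le_eqVlt; apply/orP; left; apply/eqP.
    by congr (_ * _); apply: eq_bigr => i _; rewrite ffunE.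
  rewrite -mulr_sumr ler_wpM2l ?prodr_ge0//.
  apply: le_trans (muB (fun i => c i)); apply: ler_sum_sub => // y /eqP <-.
  by apply/forallP => i; rewrite ffunE.
rewrite -mulr_suml ler_wpM2r//.
rewrite -(bigA_distr_bigA (fun i (b : 'I_M) => wt (x i %/ S) b))/=.
rewrite -[d in _ ^+ d]card_ord -prodr_const; apply: ler_prod => i _.
rewrite sumr_ge0//= (le_trans (sum_wt_le _ _))//; case: ifP => _.
  by rewrite (@le_trans _ _ 1)// ?ler1n// invf_le1 ?ler1n// ltr0n.
by rewrite lerBlDr (@le_trans _ _ 4)// ?ler_nat// lerDl invr_ge0.
Qed.

(** Per coordinate the constant collects S from Cauchy-Schwarz over the shifts, 2 from
    [sum_mu_shift], (2 / S) ^ 2 from the size of [h], (24 kap M) ^ 2 from the two kernels and 4 from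
    the sum over cells, divided by the 2 M of the auxiliary averaging: 9216 kap ^ 2 M / S. One
    factor B is the price of summing over all z, the other comes from the sum over cells. *)
Lemma large_sieve (g : X -> C) : (forall x, `|g x| <= 1) ->
  \sum_y mu y * `|\sum_x mu x * g x * \prod_i w ^+ (x i * y i)| ^+ 2
    <= (9216 * kap ^ 2)%:R ^+ d * (M%:R / S%:R) ^+ d * B ^+ 2.
Proof.
move=> /sum_chi_shift[h [h1 hE]].
have M0 : (0 < M)%N by apply: leq_trans S0 SM.
have M0C : M%:R != 0 :> C by rewrite pnatr_eq0 -lt0n.
have S0C : S%:R != 0 :> C by rewrite pnatr_eq0 -lt0n.
pose F (z : {ffun 'I_d -> 'I_(M + S)}) := `|\sum_x mu x * h x * chi (fun i => z i) x| ^+ 2.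
have F0 z : 0 <= F z by rewrite exprn_ge0.
have T1 : \sum_y mu y * `|\sum_x mu x * g x * \prod_i w ^+ (x i * y i)| ^+ 2
    <= S%:R ^+ d * (2 ^+ d * B * \sum_z F z).
  apply: le_trans (_ : \sum_y S%:R ^+ d *
     (mu y * \sum_(a : {ffun 'I_d -> 'I_S}) F (addff y a)) <= _).
    apply: ler_sum => y _; rewrite [leRHS]mulrCA ler_wpM2l// hE.
    by rewrite (le_trans (norm_sqr_sum_le _))// card_ffun !card_ord natrX.
  by rewrite -mulr_sumr ler_wpM2l ?exprn_ge0// sum_mu_shift.
(* [sum_sqr_chi_le] is applied with n = M + S and l = 2 M; n + l <= 4 M because S <= M. *)
have T2 : (\sum_z F z) * (2 * M%:R) ^+ d <=
    (2 / S%:R) ^+ d * (2 / S%:R) ^+ d * ((24 * kap * M)%:R ^+ 2) ^+ d * (4 ^+ d * B).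
  rewrite -[2]/(2%:R) -natrM -natrX; apply: le_trans (sum_sqr_chi_le _ _) _; first lia.
  apply: le_trans (_ : \sum_x mu x * ((2 / S%:R) ^+ d * (2 / S%:R) ^+ d
     * ((24 * kap * M)%:R ^+ 2) ^+ d * (4 ^+ d * B)) <= _).
    apply: ler_sum => x _.
    apply: le_trans (_ : _ <= mu x * ((2 / S%:R) ^+ d * (2 / S%:R) ^+ d
      * ((24 * kap * M)%:R ^+ 2) ^+ d) * \sum_y mu y * \prod_i wt (x i %/ S) (y i %/ S)) _.
      rewrite mulr_sumr; apply: ler_sum => y _.
      rewrite !normrM (ger0_norm (mu0 _)) (ger0_norm (mu0 _)).
      rewrite [in leLHS]mulrACA.
      have -> : \prod_i ((24 * kap * M)%:R
        / (x i %/ S - y i %/ S + (y i %/ S - x i %/ S)).+1%:R) ^+ 2 =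
        ((24 * kap * M)%:R ^+ 2) ^+ d * \prod_i wt (x i %/ S) (y i %/ S) :> C.
        rewrite -[d in _ ^+ d]card_ord -prodr_const -big_split/=.
        by apply: eq_bigr => i _; rewrite expr_div_n.
      rewrite [leRHS](_ : _ = (mu x * mu y * ((2 / S%:R) ^+ d * (2 / S%:R) ^+ d)) *
         (((24 * kap * M)%:R ^+ 2) ^+ d * \prod_i wt (x i %/ S) (y i %/ S))); last by ring.
      rewrite ler_wpM2r ?mulr_ge0 ?exprn_ge0 ?prodr_ge0//.
        by move=> i _; rewrite invr_ge0 exprn_ge0.
      by rewrite ler_wpM2l ?mulr_ge0// ler_pM.
    have K0 : 0 <= (2 / S%:R) ^+ d * (2 / S%:R) ^+ d * ((24 * kap * M)%:R ^+ 2) ^+ d :> C.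
      by rewrite -!exprMn exprn_ge0// !mulr_ge0 ?exprn_ge0 ?invr_ge0.
    by rewrite -mulrA ler_wpM2l// ler_wpM2l.
  rewrite -mulr_suml -[leRHS]mul1r ler_wpM2r// !mulr_ge0 ?exprn_ge0 ?mulr_ge0 ?invr_ge0//.
have P0 : 0 < (2 * M%:R) ^+ d :> C by rewrite exprn_gt0// mulr_gt0// ltr0n.
rewrite -(ler_pM2r P0) (le_trans (ler_wpM2r (ltW P0) T1))//.
rewrite -!mulrA.
apply: le_trans (ler_wpM2l _ (ler_wpM2l _ (ler_wpM2l B0 T2))) _; rewrite ?exprn_ge0//.
rewrite [leRHS](_ : _ = ((9216 * kap ^ 2)%:R * (M%:R / S%:R) * (2 * M%:R)) ^+ d * B ^+ 2); last first.
  by rewrite !exprMn; ring.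
rewrite [leLHS](_ : _ = (S%:R * 2 * (2 / S%:R) * (2 / S%:R) * (24 * kap * M)%:R ^+ 2 * 4) ^+ d * B ^+ 2); last first.
  by rewrite !exprMn; ring.
rewrite le_eqVlt; apply/orP; left; apply/eqP; congr (_ ^+ d * _).
by rewrite !natrM; field.
Qed.

End LargeSieve.

(** * Resampling one coordinate of an independent family *)

Section Resampling.
Variables (R : comNzRingType) (T V : finType) (mu : T -> R).

Definition ffupd (y : {ffun V -> T}) u t : {ffun V -> T} :=
  [ffun v => if v == u then t else y v].

(** Exchanging the old value at u with the fresh one is an involution of the pairs (y, t) that
    preserves their weight. *)
Lemma resampling (f : {ffun V -> T} -> R) u : \sum_t mu t = 1 ->
  \sum_(y : {ffun V -> T}) (\prod_v mu (y v)) * f y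
    = \sum_(y : {ffun V -> T}) (\prod_v mu (y v)) * \sum_t mu t * f (ffupd y u t).
Proof.
move=> mu1.
transitivity (\sum_(y : {ffun V -> T}) \sum_t (\prod_v mu (y v)) * mu t * f y).
  apply: eq_bigr => y _; rewrite -[LHS]mul1r -mu1 mulr_suml.
  by apply: eq_bigr => t _; rewrite mulrCA mulrA.
under [RHS]eq_bigr do rewrite mulr_sumr.
rewrite !pair_bigA/=.
pose h (p : {ffun V -> T} * T) := (ffupd p.1 u p.2, p.1 u).
have hK : involutive h.
  move=> [y t]; rewrite /h/= ffunE eqxx; congr (_, _); apply/ffunP => v.
  by rewrite !ffunE; case: eqP => // ->.
rewrite (reindex_inj (inv_inj hK))/=; apply: eq_bigr => -[y t] _ /=.
rewrite mulrA; congr (_ * _).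
rewrite (bigD1 u)//= [in RHS](bigD1 u)//= ffunE eqxx.
rewrite (eq_bigr (fun v => mu (y v))); last by move=> v /negbTE vu; rewrite ffunE vu.
by move: (\prod_(v | v != u) _) => Q; ring.
Qed.

Lemma sum_prod_ffun : \sum_t mu t = 1 -> \sum_(y : {ffun V -> T}) \prod_v mu (y v) = 1.
Proof. by move=> mu1; rewrite -(bigA_distr_bigA (fun=> mu))/= big1. Qed.

End Resampling.

(** * Energy of near coincidences between distances on the grid *)

(** Natural subtraction truncates at 0, so (a - b) + (b - a) is the absolute difference; cell and
    frequency differences are encoded in the same way. *)
Definition grid_sqdist d M (x y : {ffun 'I_d -> 'I_M}) : nat :=
  (\sum_i ((x i - y i) + (y i - x i)) ^ 2)%N.

Definition near_equidistant d M (L : nat) (V : finType) (B : pred V)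
    (y : {ffun V -> {ffun 'I_d -> 'I_M}}) (x x' : {ffun 'I_d -> 'I_M}) : bool :=
  [forall (u | B u), (grid_sqdist x (y u) <= grid_sqdist x' (y u) + L)%N
                   && (grid_sqdist x' (y u) <= grid_sqdist x (y u) + L)%N].

(* The indicator of near equidistance is dominated by a product of squared Dirichlet
   kernels sum_(a < M) z ^ (a (D - D')), where z has angle of order M ^ -2; expanding
   the squares gives a sum over a, a' of terms T a a', which large_sieve bounds
   according to the dyadic size of the largest a_u - a'_u. *)
Section Energy.
Variables (C : numClosedFieldType) (d m kap : nat).
Local Notation M := (2 ^ m)%N.
Local Notation X := {ffun 'I_d -> 'I_(2 ^ m)}.
Variables (mu : X -> C) (A : nat -> C) (z : C) (V : finType) (B : pred V).
Hypothesis kap0 : (0 < kap)%N.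
Hypothesis mu0 : forall x, 0 <= mu x.
Hypothesis mu1 : \sum_x mu x = 1.
Hypothesis muA : forall j, (j <= m)%N -> forall c : 'I_d -> nat,
  \sum_(x : X | [forall i, x i %/ 2 ^ (m - j) == c i]%N) mu x <= A j.
Hypothesis z1 : `|z| = 1.
Hypothesis zRe : forall n, (n <= 4 * kap * M ^ 2)%N -> 2^-1 <= 'Re (z ^+ n).
Hypothesis zsub : forall n, (n <= 4 * kap * M ^ 2)%N ->
  n%:R / (8 * kap * M ^ 2)%:R <= `|z ^+ n - 1|.

Let M0 : (0 < M)%N. Proof. by rewrite expn_gt0. Qed.

Let nsq (x : X) := (\sum_i x i ^ 2)%N.

Let grid_sqdistE (x y : X) :
  (grid_sqdist x y + 2 * \sum_i (x i * y i) = nsq x + nsq y)%N.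
Proof.
rewrite /grid_sqdist /nsq big_distrr/= -!big_split/=; apply: eq_bigr => i _.
have [xy|yx] := leqP (x i) (y i).
  rewrite (eqP xy) add0n -{2 3}(subnK xy); move: (y i - x i)%N => t; nia.
rewrite (eqP (ltnW yx)) addn0 -{2 3}(subnK (ltnW yx)); move: (x i - y i)%N => t; nia.
Qed.

Let zzC : z * z^* = 1. Proof. by rewrite -normCK z1 expr1n. Qed.

Let P (x : X) (y : {ffun V -> X}) (a : {ffun V -> 'I_M}) : C :=
  \prod_u z ^+ (B u * grid_sqdist x (y u) * a u).

Let normP x y a : `|P x y a| = 1.
Proof. by rewrite normr_prod big1// => u _; rewrite normrX z1 expr1n. Qed.

Let W (y : {ffun V -> X}) := \prod_v mu (y v).

Let W0 y : 0 <= W y. Proof. by rewrite prodr_ge0. Qed.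

Let T a a' := \sum_(y : {ffun V -> X}) W y * `|\sum_x mu x * (P x y a * (P x y a')^*)| ^+ 2.

Let T_sym a a' : T a a' = T a' a.
Proof.
apply: eq_bigr => y _; rewrite -[in LHS]norm_conjC rmorph_sum/=; congr (_ * `|_| ^+ 2).
apply: eq_bigr => x _; rewrite !rmorphM/= conjCK conj_Creal ?ger0_real//.
by rewrite [in LHS](mulrC (_^*)).
Qed.

Let T_le1 a a' : T a a' <= 1.
Proof.
rewrite -(sum_prod_ffun V mu1); apply: ler_sum => y _.
rewrite -[leRHS]mulr1 ler_wpM2l// expr_le1//.
rewrite (le_trans (ler_norm_sum _ _ _))// -mu1; apply: ler_sum => x _.
by rewrite !normrM norm_conjC !normP !mulr1 ger0_norm.
Qed.

(** Resampling isolates the pin y_u = t; the other pins go into the unimodular [g0]. With s = a_u -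
    a'_u the phase s |x - t|^2 splits into parts in x or t alone and the cross term - 2 s x.t, a
    character with base [w]. For fixed kap its angle is of order 1 / (M S), where S = 2 ^ (m - j) is
    the cell side at which mu has mass at most [A j]. *)
Let T_dyadic_lt (a a' : {ffun V -> 'I_M}) j u : (j < m)%N -> B u -> (a' u + 2 ^ j <= a u < a' u + 2 ^ j.+1)%N ->
  T a a' <= (9216 * kap ^ 2)%:R ^+ d * (2 ^ (j * d))%:R * A j ^+ 2.
Proof.
move=> jm Bu /andP[aj aj1]; rewrite /T (resampling _ u mu1).
set K := leRHS.
have -> : K = \sum_(y : {ffun V -> X}) (\prod_v mu (y v)) * K.
  by rewrite -mulr_suml (sum_prod_ffun V mu1) mul1r.
apply: ler_sum => y _.
rewrite ler_wpM2l ?W0//.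
pose s := (a u - a' u)%N.
have sE : nat_of_ord (a u) = (s + a' u)%N by rewrite subnK//; lia.
have js : (2 ^ j <= s)%N by lia.
have sj : (s < 2 ^ j.+1)%N by lia.
pose g0 x := \prod_(v | v != u) (z ^+ (B v * grid_sqdist x (y v) * a v) *
   (z ^+ (B v * grid_sqdist x (y v) * a' v))^*).
have g01 x : `|g0 x| = 1.
  by rewrite normr_prod big1// => v _; rewrite normrM norm_conjC !normrX z1 !expr1n mulr1.
pose w := (z^*) ^+ (2 * s).
have PE x t : P x (ffupd y u t) a * (P x (ffupd y u t) a')^* =
   z ^+ (s * nsq t) * (g0 x * z ^+ (s * nsq x) * \prod_i w ^+ (x i * t i)).
  rewrite /P rmorph_prod -big_split/= (bigD1 u)//= ffunE eqxx Bu mul1n.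
  have -> : \prod_(i | i != u) (z ^+ (B i * grid_sqdist x (ffupd y u t i) * a i) *
     (z ^+ (B i * grid_sqdist x (ffupd y u t i) * a' i))^*) = g0 x.
    by apply: eq_bigr => v /negbTE vu; rewrite ffunE vu.
  rewrite mulrC [RHS]mulrCA -mulrA; congr (_ * _).
  rewrite sE mulnDr exprD -mulrA -normCK normrX z1 !expr1n mulr1.
  under eq_bigr do rewrite /w -exprM.
  rewrite -expr_sum.
  rewrite mulrCA mulrA -exprD -mulnDr addnC -grid_sqdistE mulnDr exprD -mulrA.
  rewrite -big_distrr/= [(s * (2 * _))%N]mulnA [(s * 2)%N]mulnC -exprMn zzC expr1n mulr1.
  by rewrite mulnC.
pose S := (2 ^ (m - j))%N.
have S0 : (0 < S)%N by rewrite expn_gt0.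
have SM : (S <= M)%N by rewrite leq_exp2l// leq_subr.
have MS : (M = 2 ^ j * S)%N by rewrite -expnD subnKC// ltnW.
have jM : (2 ^ j.+1 <= M)%N by rewrite leq_exp2l.
have w1 : `|w| = 1 by rewrite normrX norm_conjC z1 expr1n.
have kM : (4 * (M * M) <= 4 * kap * M ^ 2)%N by rewrite -mulnn -mulnA leq_mul2l leq_pmull.
have wRe n : (n <= M * S)%N -> 2^-1 <= 'Re (w ^+ n).
  move=> nMS; rewrite -exprM -rmorphXn Re_conj zRe//.
  apply: leq_trans kM.
  have -> : (4 * (M * M) = 2 * (2 ^ j.+1 * (M * S)))%N.
    have F (b c e : nat) : (4 * (b * e * c) = 2 * (2 * b * (c * e)))%N by ring.
    by rewrite {1}MS expnS F.
  by rewrite -mulnA leq_mul2l/=; apply: leq_mul => //; exact: ltnW.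
have wsub v : (v < M)%N -> v%:R / (4 * kap * M * S)%:R <= `|w ^+ v - 1|.
  move=> vM; rewrite -exprM -norm_conjC rmorphB rmorph1 rmorphXn/= conjCK.
  apply: le_trans (zsub _); last first.
    apply: leq_trans kM.
    rewrite -mulnA; apply: leq_mul => //; apply: leq_mul; last exact: ltnW.
    exact: leq_trans (ltnW sj) jM.
rewrite ler_pdivrMr; last by rewrite ltr0n !muln_gt0 kap0 M0 S0.
  rewrite mulrAC ler_pdivlMr; last first.
    by rewrite ltr0n !muln_gt0 kap0 !expn_gt0.
  rewrite -!natrM ler_nat.
  have : (M <= s * S)%N by rewrite MS leq_mul2r js orbT.
  have : (0 < kap * M)%N by rewrite muln_gt0 kap0.
  rewrite -mulnn; move=> kM0 NrT.
  have F1 (N k T' t r : nat) : (2 * r * t * (4 * k * N * T') = 8 * (k * N) * t * (r * T'))%N by ring.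
  have F2 (N k t : nat) : (t * (8 * k * (N * N)) = 8 * (k * N) * t * N)%N by ring.
  rewrite F1 F2.
  by rewrite leq_mul2l NrT orbT.
have mu1' : \sum_t mu t <= 1 by rewrite mu1.
have g1 x : `|g0 x * z ^+ (s * nsq x)| <= 1 by rewrite normrM g01 normrX z1 expr1n mulr1.
have H := large_sieve S0 SM kap0 mu0 mu1' (muA (ltnW jm)) w1 wRe wsub g1.
apply: le_trans (le_trans H _); last first.
  have -> : M%:R / S%:R = (2 ^ j)%:R :> C by rewrite MS natrM mulfK// pnatr_eq0 -lt0n.
  by rewrite /K expnM (natrX _ (2 ^ j)%N d).
apply: ler_sum => t _; rewrite ler_wpM2l// le_eqVlt; apply/orP; left; apply/eqP; congr (_ ^+ 2).
under eq_bigr do rewrite PE mulrCA.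
rewrite -mulr_sumr normrM normrX z1 expr1n mul1r; congr (`|_|).
by apply: eq_bigr => x _; rewrite [LHS]mulrA.
Qed.

Let T_dyadic (a a' : {ffun V -> 'I_M}) j u : (j < m)%N -> B u ->
  (2 ^ j <= (a u - a' u) + (a' u - a u) < 2 ^ j.+1)%N ->
  T a a' <= (9216 * kap ^ 2)%:R ^+ d * (2 ^ (j * d))%:R * A j ^+ 2.
Proof.
move=> jm Bu; have [le|lt] := leqP (a' u) (a u) => H.
  by apply: (T_dyadic_lt jm Bu); lia.
by rewrite T_sym; apply: (T_dyadic_lt jm Bu); lia.
Qed.

Let close (L : nat) (a a' : {ffun V -> 'I_M}) :=
  [forall (u | B u), (a u - a' u) + (a' u - a u) < L]%N.

Let K0 j : (j <= m)%N -> 0 <= (9216 * kap ^ 2)%:R ^+ d * (2 ^ (j * d))%:R * A j ^+ 2.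
Proof.
move=> jm; have A0 : 0 <= A j by apply: le_trans (muA jm (fun=> 0%N)); exact: sumr_ge0.
by rewrite mulr_ge0 ?exprn_ge0// mulr_ge0 ?exprn_ge0.
Qed.

(** The pin u in B with the largest difference determines j: the sieve is applied there, and
    maximality puts all differences on B below 2 ^ (j + 1), which keeps such pairs few. Pairs
    agreeing on B get the trivial bound 1. *)
Let T_le a a' : T a a' <= (close 1 a a')%:R + \sum_(j < m) (close (2 ^ j.+1) a a')%:R *
  ((9216 * kap ^ 2)%:R ^+ d * (2 ^ (j * d))%:R * A j ^+ 2).
Proof.
have sum0 : 0 <= \sum_(j < m) (close (2 ^ j.+1) a a')%:R *
  ((9216 * kap ^ 2)%:R ^+ d * (2 ^ (j * d))%:R * A j ^+ 2).
  by apply: sumr_ge0 => j _; rewrite mulr_ge0// K0// ltnW.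
have [c1|/forallPn[u0]] := boolP (close 1 a a').
  by rewrite (le_trans (T_le1 a a'))// lerDl.
rewrite negb_imply -leqNgt => /andP[Bu0 au0].
rewrite add0r.
pose dist u := ((a u - a' u) + (a' u - a u))%N.
case: (arg_maxnP dist Bu0) => u Bu umax.
have u1 : (0 < dist u)%N by apply: leq_trans au0 (umax _ Bu0).
have uM : (dist u < M)%N by rewrite /dist; have := ltn_ord (a u); have := ltn_ord (a' u); lia.
have /andP[jl ju] := trunc_log_bounds (isT : 1 < 2)%N u1.
set j := trunc_log 2 (dist u) in jl ju.
have jm : (j < m)%N by rewrite -(ltn_exp2l _ _ (isT : 1 < 2)%N); apply: leq_ltn_trans uM.
rewrite (bigD1 (Ordinal jm))//= (_ : close (2 ^ j.+1) a a'); last first.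
  by apply/forallP => v; apply/implyP => /umax; rewrite -/(dist v) => /leq_ltn_trans; apply.
rewrite mul1r (le_trans (T_dyadic jm Bu _))//; first by rewrite jl.
by rewrite lerDl; apply: sumr_ge0 => i _; rewrite mulr_ge0// K0// ltnW.
Qed.

Let sum_close_le L b n : (\sum_(b' < n) ((b - b') + (b' - b) < L) <= 2 * L)%N.
Proof.
(* The right side is the length of the part below n of the interval from b + 1 - L to b + L; unlike
   2 L, it carries the induction. *)
suff : (\sum_(b' < n) ((b - b') + (b' - b) < L) <= minn n (b + L) - (b.+1 - L))%N by lia.
elim: n => [|n IH]; first by rewrite big_ord0.
rewrite big_ord_recr/=; move: IH; set t := (\sum_(_ < n) _)%N => IH.
by case: ltnP => /=; lia.
Qed.

Let count_close L : ((\sum_a \sum_a' close L a a') * M ^ #|B|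
   <= (2 * L) ^ #|B| * M ^ (2 * #|V|))%N.
Proof.
pose f u (b b' : 'I_M) : nat := B u ==> ((b - b') + (b' - b) < L)%N.
have -> : (\sum_a \sum_a' close L a a' = \prod_u \sum_b \sum_b' f u b b')%N.
  rewrite bigA_distr_bigA/=; apply: eq_bigr => a _.
  rewrite (bigA_distr_bigA (fun u => f u (a u)))/=; apply: eq_bigr => a' _.
  rewrite /close; case: forallP => [c|nc].
    by rewrite big1// => u _; rewrite /f (c u).
  have [u nu|al] := pickP (fun u => ~~ (B u ==> ((a u - a' u) + (a' u - a u) < L))%N).
    by rewrite (bigD1 u)//= /f (negbTE nu).
  by case: nc; move=> v; move/negbFE: (al v).
apply: leq_trans (_ : (\prod_(u in V) (M * (if B u then 2 * L else M))) * M ^ #|B| <= _)%N.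
  rewrite leq_mul2r; apply/orP; right; apply: leq_prod => u _.
  rewrite -[X in (_ <= X * _)%N]card_ord -sum_nat_const; apply: leq_sum => b _.
  rewrite /f; case: (B u) => //=; last by rewrite sum1_card card_ord.
  exact: sum_close_le.
have E : ((\prod_(u in V) (if B u then 2 * L else M)) * M ^ #|B| = (2 * L) ^ #|B| * M ^ #|V|)%N.
  rewrite (eq_bigr (fun u => (if B u then 2 * L else 1) * (if ~~ B u then M else 1)))%N; last first.
    by move=> u _; case: (B u); rewrite ?muln1 ?mul1n.
  rewrite big_split/= -!big_mkcond/= !prod_nat_const -mulnA -expnD addnC.
  by rewrite -(cardC B).
by rewrite big_split/= prod_nat_const -mulnA E mulnCA -expnD (mul2n #|V|) -addnn.
Qed.

(** If the two squared distances to y_u differ by at most kap M, all terms of the Dirichlet sum at u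
    have real part at least 1/2, so its square is at least M ^ 2 / 4: a factor 4 for each u in B.
    Outside B the exponent vanishes and the sum is exactly M. *)
Let near_le y x x' : (near_equidistant (kap * M) B y x x')%:R * M%:R ^+ (2 * #|V|) <=
  4 ^+ #|B| * `|\sum_a P x y a * (P x' y a)^*| ^+ 2.
Proof.
rewrite /near_equidistant; case: forallP => [near|_]; last by rewrite mul0r mulr_ge0 ?exprn_ge0.
rewrite mul1r mulnC exprM.
have -> : \sum_a P x y a * (P x' y a)^* = \prod_u \sum_(b < M)
  (z ^+ (B u * grid_sqdist x (y u) * b) * (z ^+ (B u * grid_sqdist x' (y u) * b))^*).
  rewrite bigA_distr_bigA/=; apply: eq_bigr => a _.
  by rewrite rmorph_prod -big_split.
rewrite normr_prod -prodrXl.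
have -> : 4 ^+ #|B| = \prod_u (if B u then 4 else 1) :> C.
  by rewrite -big_mkcond/= prodr_const.
rewrite -big_split/= -prodr_const -prodrXl; apply: ler_prod => u _.
rewrite !exprn_ge0//=; case Bu: (B u); last first.
  rewrite mul1r (eq_bigr (fun=> 1)) ?sumr_const ?card_ord ?normr_nat// => b _.
  by rewrite !mul0n !expr0 rmorph1 mulr1.
have := near u; rewrite Bu/= => /andP[n1 n2].
set q := \sum_(b < M) _.
suff : M%:R / 2 <= `|q|.
  have e4 : 2 ^+ 2 = 4 :> C by rewrite -natrX.
  rewrite -(ler_pXn2r (isT : 0 < 2)%N) ?nnegrE ?divr_ge0// expr_div_n.
  by rewrite ler_pdivrMr ?exprn_gt0// mulrC e4 natrX.
apply: le_trans (_ : 'Re q <= _); last exact: (leif_Re_Creal _).1.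
rewrite raddf_sum/= -[M in M%:R]card_ord mulr_natl -sumr_const; apply: ler_sum => b _.
rewrite !mul1n; move: n1 n2; move: (grid_sqdist _ _) (grid_sqdist _ _) => D' D n1 n2.
have bM := ltn_ord b.
have bound N : (N <= kap * M -> N * b <= 4 * kap * M ^ 2)%N.
  move=> NM; rewrite -mulnn; apply: (leq_trans (leq_mul NM (ltnW bM))); nia.
have [DD|DD] := leqP D' D.
rewrite -(subnK DD) mulnDl exprD -mulrA -normCK normrX z1 !expr1n mulr1.
  by apply/zRe/bound; lia.
rewrite -(subnK (ltnW DD)) mulnDl exprD rmorphM/= mulrCA -normCK normrX z1 !expr1n mulr1 Re_conj.
by apply/zRe/bound; lia.
Qed.

(** Each pin in B costs 4 from [near_le], times 2 L from counting pairs at distance less than L: 8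
    for L = 1, and 16 * 2 ^ j for L = 2 ^ (j + 1). *)
Theorem energy_le :
  (\sum_(y : {ffun V -> X}) (\prod_v mu (y v)) *
     \sum_x \sum_x' mu x * mu x' * (near_equidistant (kap * M) B y x x')%:R) * M%:R ^+ #|B|
  <= 8 ^+ #|B| + \sum_(j < m) (16 * 2 ^ j)%:R ^+ #|B| *
       ((9216 * kap ^ 2)%:R ^+ d * (2 ^ (j * d))%:R * A j ^+ 2).
Proof.
have MC : 0 < M%:R ^+ (2 * #|V|) :> C by rewrite exprn_gt0// ltr0n.
set En := \sum_y _.
have H1 : En * M%:R ^+ (2 * #|V|) <= 4 ^+ #|B| * \sum_a \sum_a' T a a'.
  apply: le_trans (_ : \sum_(y : {ffun V -> X}) W y * \sum_x \sum_x' mu x * mu x' *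
     (4 ^+ #|B| * `|\sum_a P x y a * (P x' y a)^*| ^+ 2) <= _).
    rewrite /En mulr_suml; apply: ler_sum => y _; rewrite -mulrA ler_wpM2l ?W0//.
    rewrite mulr_suml; apply: ler_sum => x _; rewrite mulr_suml; apply: ler_sum => x' _.
    by rewrite -mulrA ler_wpM2l ?mulr_ge0// near_le.
  rewrite le_eqVlt; apply/orP; left; apply/eqP.
  transitivity (\sum_(y : {ffun V -> X}) 4 ^+ #|B| *
     \sum_a \sum_a' W y * `|\sum_x mu x * (P x y a * (P x y a')^*)| ^+ 2); last first.
    rewrite -mulr_sumr exchange_big/=; congr (_ * _); apply: eq_bigr => a _.
    by rewrite exchange_big.
  apply: eq_bigr => y _.
  under eq_bigr do under eq_bigr do rewrite mulrCA.
  under eq_bigr do rewrite -mulr_sumr.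
  rewrite -mulr_sumr mulrCA; congr (_ * _).
  under [RHS]eq_bigr do rewrite -mulr_sumr.
  rewrite -mulr_sumr; congr (_ * _).
  transitivity (\sum_x \sum_x' \sum_a \sum_a' (mu x * (P x y a * (P x y a')^*)) *
     (mu x' * (P x' y a * (P x' y a')^*))^*).
    apply: eq_bigr => x _; apply: eq_bigr => x' _.
    rewrite normCK rmorph_sum/= big_distrlr/= mulr_sumr; apply: eq_bigr => a _.
    rewrite mulr_sumr; apply: eq_bigr => a' _.
    rewrite !rmorphM/= !conjCK (conj_Creal (ger0_real (mu0 x'))); ring.
  rewrite exchange_big/=; under eq_bigr do rewrite exchange_big/=.
  rewrite exchange_big/=; apply: eq_bigr => a _.
  under eq_bigr do rewrite exchange_big/=.
  rewrite exchange_big/=; apply: eq_bigr => a' _.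
  rewrite normCK rmorph_sum/= big_distrlr/= exchange_big//.
have H2 : (\sum_a \sum_a' T a a') * M%:R ^+ #|B| <=
   (2 ^+ #|B| + \sum_(j < m) (4 * 2 ^ j)%:R ^+ #|B| *
     ((9216 * kap ^ 2)%:R ^+ d * (2 ^ (j * d))%:R * A j ^+ 2)) * M%:R ^+ (2 * #|V|).
  have cl L : (\sum_a \sum_a' (close L a a')%:R) * M%:R ^+ #|B|
     <= (2 * L)%:R ^+ #|B| * M%:R ^+ (2 * #|V|) :> C.
    under eq_bigr do rewrite -natr_sum.
    by rewrite -natr_sum -!natrX -!natrM ler_nat count_close.
  apply: le_trans (_ : (\sum_a \sum_a' ((close 1 a a')%:R + \sum_(j < m) (close (2 ^ j.+1) a a')%:R *
    ((9216 * kap ^ 2)%:R ^+ d * (2 ^ (j * d))%:R * A j ^+ 2))) * M%:R ^+ #|B| <= _).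
    by rewrite ler_wpM2r ?exprn_ge0//; apply: ler_sum => a _; apply: ler_sum => a' _.
  under eq_bigr do rewrite big_split/=.
  rewrite big_split/= !mulrDl lerD ?cl//.
  under eq_bigr do rewrite exchange_big/=.
  rewrite exchange_big/= !mulr_suml; apply: ler_sum => j _.
  under eq_bigr do rewrite -mulr_suml.
  rewrite -mulr_suml mulrAC [leRHS]mulrAC ler_wpM2r//.
    by rewrite K0// ltnW.
  by rewrite (le_trans (cl _))// expnS mulnA.
have H3 : En * M%:R ^+ #|B| * M%:R ^+ (2 * #|V|) <= 4 ^+ #|B| *
   (2 ^+ #|B| + \sum_(j < m) (4 * 2 ^ j)%:R ^+ #|B| *
     ((9216 * kap ^ 2)%:R ^+ d * (2 ^ (j * d))%:R * A j ^+ 2)) * M%:R ^+ (2 * #|V|).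
  rewrite mulrAC (le_trans (ler_wpM2r _ H1)) ?exprn_ge0// -!mulrA ler_wpM2l ?exprn_ge0//.
move: H3; rewrite (ler_pM2r MC) => /le_trans; apply.
rewrite mulrDr mulr_sumr -exprMn -natrM le_eqVlt; apply/orP; left; apply/eqP.
congr (_ + _); apply: eq_bigr => j _.
by rewrite mulrA -exprMn -[4]/(4%:R) -natrM mulnA.
Qed.

End Energy.

(** * Elementary bounds on the unit circle *)

Section UnitCircle.
Variable R : realType.

Lemma sin_mvt (x : R) : 0 <= x -> exists2 c, 0 <= c <= x & sin x = cos c * x.
Proof.
move=> x0.
have [|c cx] := @MVT_segment R sin cos 0 x x0.
  by apply: continuous_subspaceT; exact: continuous_sin.
by rewrite sin0 !subr0 => ->; exists c => //; rewrite in_itv/= in cx.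
Qed.

(** From cos x = 1 - 2 sin(x / 2) ^ 2 and |sin(x / 2)| <= x / 2, which avoids any numerical estimate
    of pi. *)
Lemma cos_ge_half (x : R) : 0 <= x <= 1 -> 2^-1 <= cos x.
Proof.
move=> /andP[x0 x1].
have y0 : 0 <= x / 2 by rewrite divr_ge0.
have sy : `|sin (x / 2)| <= x / 2.
  have [c _ ->] := sin_mvt y0.
  by rewrite normrM (ger0_norm y0) ler_piMl// cos_max.
have -> : x = (x / 2) *+ 2 by rewrite mulr2n; field.
rewrite cos_mulr2n cos2sin2.
have : sin (x / 2) ^+ 2 <= (x / 2) ^+ 2 by rewrite -real_normK ?num_real// lerXn2r ?nnegrE.
nra.
Qed.

Lemma sin_ge_half (x : R) : 0 <= x <= 1 -> x / 2 <= sin x.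
Proof.
move=> /andP[x0 x1]; have [c /andP[c0 cx] ->] := sin_mvt x0.
by rewrite mulrC ler_wpM2r// cos_ge_half// c0 (le_trans cx).
Qed.

Local Open Scope complex_scope.

Definition cis (x : R) : R[i] := cos x +i* sin x.

Lemma cisX x n : cis x ^+ n = cis (n%:R * x).
Proof.
elim: n => [|n IH]; first by rewrite expr0 mul0r /cis cos0 sin0.
rewrite exprS IH -natr1 mulrDl mul1r addrC /cis cosD sinD.
by apply/eqP; rewrite eq_complex/=; apply/andP; split; apply/eqP; ring.
Qed.

Lemma norm_cis x : `|cis x| = 1.
Proof. by rewrite normc_def/= cos2Dsin2 sqrtr1. Qed.

Lemma Re_cis_ge x : 0 <= x <= 1 -> 2^-1 <= 'Re (cis x).
Proof.
move=> x1; rewrite -complexRe/=.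
by rewrite (_ : 2^-1 = (2^-1)%:C) ?lecR ?cos_ge_half// fmorphV rmorph_nat.
Qed.

Lemma norm_cis_sub1_ge x : 0 <= x <= 1 -> (x / 2)%:C <= `|cis x - 1|.
Proof.
move=> x1; rewrite normc_def lecR/= subr0.
have s := sin_ge_half x1; have /andP[x0 _] := x1.
rewrite -[leLHS]ger0_norm ?divr_ge0// -sqrtr_sqr ler_wsqrtr//.
rewrite ler_wpDl ?sqr_ge0// lerXn2r ?nnegrE ?divr_ge0//.
by apply: le_trans s; rewrite divr_ge0.
Qed.

End UnitCircle.

(** * The energy bound for real measures of Frostman type *)

Section RealEnergy.
Variables (R : realType) (d m kap : nat).
Local Notation M := (2 ^ m)%N.
Local Notation X := {ffun 'I_d -> 'I_(2 ^ m)}.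
Variables (mu : X -> R) (A : nat -> R) (V : finType) (B : pred V).
Hypothesis kap0 : (0 < kap)%N.
Hypothesis mu0 : forall x, 0 <= mu x.
Hypothesis mu1 : \sum_x mu x = 1.
Hypothesis muA : forall j, (j <= m)%N -> forall c : 'I_d -> nat,
  \sum_(x : X | [forall i, x i %/ 2 ^ (m - j) == c i]%N) mu x <= A j.

Definition energy (L : nat) : R :=
  \sum_(y : {ffun V -> X}) (\prod_v mu (y v)) *
     \sum_x \sum_x' mu x * mu x' * (near_equidistant L B y x x')%:R.

Local Open Scope complex_scope.

Lemma energy_le_dyadic : energy (kap * M) * M%:R ^+ #|B|
  <= 8 ^+ #|B| + \sum_(j < m) (16 * 2 ^ j)%:R ^+ #|B| *
       ((9216 * kap ^ 2)%:R ^+ d * (2 ^ (j * d))%:R * A j ^+ 2).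
Proof.
pose rC := real_complex R.
(* With this angle all powers up to 4 kap M ^ 2 turn by at most one radian, the range in which both
   the cosine and the chord bounds hold. *)
pose z := cis ((4 * kap * M ^ 2)%:R^-1 : R).
have N0 : 0 < (4 * kap * M ^ 2)%:R :> R by rewrite ltr0n !muln_gt0 kap0 !expn_gt0.
have zn n : (n <= 4 * kap * M ^ 2)%N -> 0 <= n%:R * ((4 * kap * M ^ 2)%:R^-1 : R) <= 1.
  by move=> nN; rewrite mulr_ge0 ?invr_ge0//= ler_pdivrMr// mul1r ler_nat.
have zRe n : (n <= 4 * kap * M ^ 2)%N -> 2^-1 <= 'Re (z ^+ n).
  by move=> nN; rewrite cisX Re_cis_ge// zn.
have zsub n : (n <= 4 * kap * M ^ 2)%N -> n%:R / (8 * kap * M ^ 2)%:R <= `|z ^+ n - 1|.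
  move=> nN; rewrite cisX; apply: le_trans (norm_cis_sub1_ge (zn n nN)).
  rewrite -mulrA -invfM -natrM (_ : 4 * kap * M ^ 2 * 2 = 8 * kap * M ^ 2)%N; last by lia.
  by rewrite (rmorphM rC) (fmorphV rC) !(rmorph_nat rC).
have mu0C x : 0 <= (mu x)%:C by rewrite -(rmorph0 (real_complex R)) lecR.
have mu1C : \sum_x (mu x)%:C = 1 by rewrite -(rmorph_sum rC) mu1 rmorph1.
have muAC j : (j <= m)%N -> forall c : 'I_d -> nat,
  \sum_(x : X | [forall i, x i %/ 2 ^ (m - j) == c i]%N) (mu x)%:C <= (A j)%:C.
  by move=> jm c; rewrite -(rmorph_sum rC) lecR muA.
have := energy_le B kap0 mu0C mu1C muAC (norm_cis _) zRe zsub.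
set S := leRHS; have -> : S = (8 ^+ #|B| + \sum_(j < m) (16 * 2 ^ j)%:R ^+ #|B| *
       ((9216 * kap ^ 2)%:R ^+ d * (2 ^ (j * d))%:R * A j ^+ 2))%:C.
  rewrite (rmorphD rC) (rmorphXn rC) (rmorph_nat rC); congr (_ + _).
  rewrite (rmorph_sum rC); apply: eq_bigr => j _.
  by rewrite !(rmorphM rC) !(rmorphXn rC) !(rmorph_nat rC).
set E := leLHS; have -> : E = (energy (kap * M) * M%:R ^+ #|B|)%:C.
  rewrite (rmorphM rC) (rmorphXn rC) (rmorph_nat rC); congr (_ * _).
  rewrite (rmorph_sum rC); apply: eq_bigr => y _.
  rewrite (rmorphM rC) (rmorph_prod rC) (rmorph_sum rC); congr (_ * _); apply: eq_bigr => x _.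
  rewrite (rmorph_sum rC); apply: eq_bigr => x' _.
  by rewrite !(rmorphM rC) (rmorph_nat rC).
by rewrite lecR.
Qed.

(** Under exponential decay of [A] the term of scale j is a constant times (2 ^ (d + k) q ^ 2) ^ j,
    so the sum is bounded independently of m. This is where the dimension threshold enters. *)
Lemma energy_le_geometric (A0 q : R) (k : nat) :
  0 <= A0 -> 0 <= q -> (#|B| <= k)%N -> (forall j, A j = A0 * q ^+ j) ->
  2 ^+ (d + k) * q ^+ 2 < 1 ->
  energy (kap * M) * M%:R ^+ #|B| <=
    8 ^+ k + 16 ^+ k * (9216 * kap ^ 2)%:R ^+ d * A0 ^+ 2 / (1 - 2 ^+ (d + k) * q ^+ 2).
Proof.
move=> A00 q0 Bk AE; set rho := 2 ^+ (d + k) * q ^+ 2 => rho1.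
apply: le_trans energy_le_dyadic _; apply: lerD.
  by rewrite ler_weXn2l// ler1n.
have rho0 : 0 <= rho by rewrite mulr_ge0 ?exprn_ge0.
set K := 16 ^+ k * _ * _.
have K0 : 0 <= K by rewrite !mulr_ge0 ?exprn_ge0.
apply: le_trans (_ : \sum_(j < m) K * rho ^+ j <= _).
  apply: ler_sum => j _; rewrite AE.
  apply: le_trans (_ : (16 * 2 ^ j)%:R ^+ k *
    ((9216 * kap ^ 2)%:R ^+ d * (2 ^ (j * d))%:R * (A0 * q ^+ j) ^+ 2) <= _).
    rewrite ler_wpM2r ?mulr_ge0 ?exprn_ge0//.
    by rewrite ler_weXn2l// ler1n muln_gt0 expn_gt0.
  have e1 : (16 * 2 ^ j)%:R ^+ k = 16 ^+ k * 2 ^+ (j * k) :> R.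
    by rewrite natrM exprMn (natrX _ 2) exprM.
  have e2 : (2 ^ (j * d))%:R = 2 ^+ (j * d) :> R by rewrite (natrX _ 2).
  have e3 : (A0 * q ^+ j) ^+ 2 = A0 ^+ 2 * q ^+ (j * 2) by rewrite exprMn exprM.
  have e4 : rho ^+ j = 2 ^+ (j * d) * 2 ^+ (j * k) * q ^+ (j * 2).
    by rewrite /rho exprMn -!exprM -exprD -mulnDr mulnC [(2 * j)%N]mulnC.
  rewrite e1 e2 e3 e4 /K le_eqVlt; apply/orP; left; apply/eqP.
  move: (_ ^+ d) (2 ^+ (j * k)) (2 ^+ (j * d)) (q ^+ (j * 2)) (16 ^+ k) => a b c e f.
  by ring.
rewrite -mulr_sumr ler_wpM2l//.
have r1 : 0 < 1 - rho by rewrite subr_gt0.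
rewrite -[X in _ <= X]mul1r ler_pdivlMr// mulrC.
have -> : (1 - rho) * \sum_(i < m) rho ^+ i = 1 - rho ^+ m.
  by rewrite -[X in X * _]opprB mulNr -subrX1 opprB.
by rewrite lerBlDr lerDl exprn_ge0.
Qed.

End RealEnergy.

(** * Adding the vertices of the graph one at a time *)

Section GraphInduction.
Variables (R : realType) (n : nat) (e : rel 'I_n).

Definition edges_in (S : {set 'I_n}) : pred ('I_n * 'I_n) :=
  fun p => [&& edge_of e p, p.1 \in S & p.2 \in S].

Section DistanceVectors.
Variables (X T : finType) (mu : X -> R) (tau : X -> X -> T).

(** The vector is indexed by all pairs, with [None] off the edges inside S, so that vectors for
    different S share one finite type and deleting a vertex is a masking. *)
Definition dist_vector (S : {set 'I_n}) (x : {ffun 'I_n -> X}) :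
    {ffun 'I_n * 'I_n -> option T} :=
  [ffun p => if edges_in S p then Some (tau (x p.1) (x p.2)) else None].

Definition dist_prob (S : {set 'I_n}) (N : pred {ffun 'I_n * 'I_n -> option T}) : R :=
  \sum_(x : {ffun 'I_n -> X}) (\prod_v mu (x v)) * (N (dist_vector S x))%:R.

(** The chance that two independent points have the same [tau] to all pins in B, averaged over the
    pins: a discrete squared L2 norm of the law of the distances to the pins. *)
Definition tau_energy (B : pred 'I_n) : R :=
  \sum_(y : {ffun 'I_n -> X}) (\prod_v mu (y v)) *
    \sum_x \sum_x' mu x * mu x' * [forall (u | B u), tau x (y u) == tau x' (y u)]%:R.

End DistanceVectors.

Lemma card_edges_in_le (S : {set 'I_n}) v : symmetric e ->
  (#|edges_in S| <= #|edges_in (S :\ v)| + #|[pred u in S | e v u]|)%N.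
Proof.
move=> es.
pose f (u : 'I_n) := if (u < v)%N then (u, v) else (v, u).
apply: leq_trans (_ : #|[predU edges_in (S :\ v) & [seq f u | u in [pred u in S | e v u]]]| <= _)%N.
  apply/subset_leq_card/fintype.subsetP => -[a b]; rewrite !inE /edges_in /edge_of/=.
  move=> /and3P[/andP[/= ab eab] /= aS bS]; rewrite [X in X || _]unfold_in/= !inE aS bS !andbT.
  have [av|av] := eqVneq a v.
    apply/orP; right. apply/fintype.imageP; exists b; first by rewrite !inE bS -av.
    by rewrite /f -av ltnNge (ltnW ab).
  have [bv|bv] := eqVneq b v; last by rewrite ab eab.
  apply/orP; right; apply/fintype.imageP; exists a; first by rewrite !inE aS -bv es.
  by rewrite /f -bv ab.
apply: leq_trans (_ : #|edges_in (S :\ v)| + #|[seq f u | u in [pred u in S | e v u]]| <= _)%N.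
  by rewrite -cardUI leq_addr.
by rewrite leq_add2l leq_image_card.
Qed.

(* Induction on S, removing a vertex v with at most k neighbours: conditionally on
   the other vertices, the new distances have density rho, and
   rho <= lam + rho ^ 2 / lam splits the probability into a counting term and an
   energy term. *)
Lemma dist_prob_small (k : nat) (C : R) : simple_graph e -> degenerate_le e k -> 0 <= C ->
  forall (S : {set 'I_n}) (eps : R), 0 < eps ->
  exists2 eta : R, 0 < eta &
  forall (X T : finType) (mu : X -> R) (tau : X -> X -> T) (M : nat),
    (0 < M)%N -> (forall x, 0 <= mu x) -> \sum_x mu x = 1 ->
    (forall x y, tau x y = tau y x) ->
    (forall B : pred 'I_n, (#|B| <= k)%N -> tau_energy mu tau B * M%:R ^+ #|B| <= C) ->
  forall N : pred {ffun 'I_n * 'I_n -> option T},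
    #|N|%:R <= eta * M%:R ^+ #|edges_in S| -> dist_prob mu tau S N <= eps.
Proof.
move=> [es ei] deg C0 S; move: {2}#|S| (leqnn #|S|) => c.
elim: c S => [|c IH] S Sc eps eps0.
  move: Sc; rewrite leqn0 cards_eq0 => /eqP S0.
  (* Without edges the hypothesis reads |N| <= 1/2, which forces N to be empty. *)
  exists 2^-1; first by rewrite invr_gt0.
  move=> X T mu tau M M0 mu0 mu1 tauC en N.
  rewrite (_ : #|edges_in S| = 0%N); last first.
    by apply: eq_card0 => p; rewrite unfold_in /edges_in S0 !inE/= ?andbF.
  rewrite expr0 mulr1 => Nle.
  have N0 : #|N| = 0%N.
    apply/eqP; rewrite -leqn0 -ltnS -(ltr_nat R); apply: le_lt_trans Nle _.
    by rewrite invf_lt1// ltr1n.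
  rewrite /dist_prob big1 ?ltW// => x _.
  by have := card0_eq N0 (dist_vector tau S x); rewrite !unfold_in => ->; rewrite mulr0.
have [S0|Sn0] := eqVneq S finset.set0.
  by apply: IH => //; rewrite S0 cards0.
have [v vS Bk] := deg S Sn0.
pose B : pred 'I_n := [pred u in S | e v u].
have {}Bk : (#|B| <= k)%N by rewrite cardsE in Bk.
have eps3 : 0 < eps / 3 by rewrite divr_gt0.
have S'c : (#|(S :\ v)%SET| <= c)%N by move: Sc; rewrite (cardsD1 v) vS.
have [eta' eta'0 IHv] := IH _ S'c _ eps3.
(* L >= 3 C / eps brings the energy term below eps / 3, and th L = eps / 3 is the counting term; the
   + 1 keeps L positive when C = 0. *)
pose L := 3 * C / eps + 1.
have L0 : 0 < L by rewrite ltr_wpDl// !mulr_ge0 ?invr_ge0// ltW.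
pose th := eps / 3 / L.
have th0 : 0 < th by rewrite divr_gt0.
exists (th * eta'); first by rewrite mulr_gt0.
move=> X T mu tau M M0 mu0 mu1 tauC en N Nle.
have MC : 0 < M%:R :> R by rewrite ltr0n.
set k' := #|B| in Bk.
pose lam := L / M%:R ^+ k'.
have lam0 : 0 < lam by rewrite divr_gt0// exprn_gt0.
pose S' := (S :\ v)%SET.
pose restr (xi : {ffun 'I_n * 'I_n -> option T}) :=
  [ffun p => if edges_in S' p then xi p else None].
pose fib sg := [pred xi | N xi & restr xi == sg].
(* The restricted vectors with more than th M ^ k' extensions in N. They number at most |N| / (th M
   ^ k'), so the induction hypothesis bounds their probability; every other restriction has few
   extensions to count. *)
pose N' : pred {ffun 'I_n * 'I_n -> option T} := fun sg => th * M%:R ^+ k' < #|fib sg|%:R.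
have N'le : #|N'|%:R <= eta' * M%:R ^+ #|edges_in S'|.
  have tM : 0 < th * M%:R ^+ k' by rewrite mulr_gt0// exprn_gt0.
  rewrite -(ler_pM2l tM).
  apply: le_trans (_ : #|N|%:R <= _).
    rewrite -[in leRHS]sum1_card (partition_big restr xpredT)//= natr_sum.
    rewrite mulr_natr -sumr_const big_mkcond; apply: ler_sum => sg _.
    case: ifP => [|_]; last exact: ler0n.
    rewrite unfold_in /N' => /ltW/le_trans; apply.
    by rewrite -sum1_card.
  apply: le_trans Nle _.
  rewrite [leRHS]mulrACA -exprD ler_wpM2l ?(ltW (mulr_gt0 th0 eta'0))//.
  by rewrite ler_weXn2l ?ler1n// addnC card_edges_in_le.
pose dv x t := dist_vector tau S (ffupd x v t).
pose rho x xi := \sum_t mu t * (dv x t == xi)%:R.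
have rho0 x xi : 0 <= rho x xi by apply: sumr_ge0 => t _; rewrite mulr_ge0.
have restr_dv x t : restr (dv x t) = dist_vector tau S' x.
  apply/ffunP => p; rewrite !ffunE; case: ifP => //.
  rewrite /edges_in !inE => /and3P[ep /andP[/negbTE p1 p1S] /andP[/negbTE p2 p2S]].
  by rewrite ep p1S p2S/= p1 p2.
have sumN x : \sum_t mu t * (N (dv x t))%:R = \sum_(xi | N xi) rho x xi.
  rewrite exchange_big/=; apply: eq_bigr => t _; rewrite -mulr_sumr; congr (_ * _).
  case: (boolP (N (dv x t))) => Nx.
    rewrite (bigD1 (dv x t))//= eqxx big1 ?addr0// => xi /andP[_].
    by rewrite eq_sym => /negbTE ->.
  by rewrite big1// => xi Nxi; case: eqP => // E; rewrite E Nxi in Nx.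
have pt x : \sum_t mu t * (N (dv x t))%:R <=
   (N' (dist_vector tau S' x))%:R + L * th + lam^-1 * \sum_xi rho x xi ^+ 2.
  have sq0 : 0 <= lam^-1 * \sum_xi rho x xi ^+ 2.
    by rewrite mulr_ge0 ?invr_ge0 ?(ltW lam0)// sumr_ge0// => xi _; rewrite exprn_ge0.
  case N'x : (N' _).
    apply: (@le_trans _ _ (\sum_t mu t)).
      by apply: ler_sum => t _; rewrite ler_piMr// lern1 leq_b1.
    by rewrite mu1 -addrA lerDl addr_ge0// mulr_ge0// ltW.
  rewrite add0r sumN.
  apply: le_trans (_ : \sum_(xi | fib (dist_vector tau S' x) xi) (lam + lam^-1 * rho x xi ^+ 2) <= _).
    rewrite (bigID (fun xi => restr xi == dist_vector tau S' x))/= [X in _ + X]big1 ?addr0.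
      apply: ler_sum => xi _; set r := rho x xi.
      rewrite -(ler_pM2l lam0) mulrDr mulVKf ?gt_eqF// -subr_ge0.
      have -> : lam * lam + r ^+ 2 - lam * r = (lam - r / 2) ^+ 2 + (3 / 4) * r ^+ 2 by field.
      by rewrite addr_ge0 ?sqr_ge0// mulr_ge0 ?sqr_ge0.
    move=> xi /andP[_ rx]; rewrite /rho big1// => t _.
    case: eqP => [E|_]; last by rewrite mulr0.
    by rewrite -E restr_dv eqxx in rx.
  rewrite big_split/= lerD//.
    rewrite sumr_const -mulr_natr.
    move/negbT: N'x; rewrite -leNgt => /(ler_wpM2l (ltW lam0)) /le_trans; apply.
    have Mk0 : M%:R ^+ k' != 0 :> R by rewrite expf_neq0 ?gt_eqF.
    by rewrite /lam mulrCA (mulfVK Mk0) mulrC lexx.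
  rewrite -mulr_sumr ler_wpM2l ?invr_ge0 ?(ltW lam0)//.
  by rewrite [leRHS](bigID (fib (dist_vector tau S' x)))/= lerDl sumr_ge0// => xi _; rewrite exprn_ge0.
(* The second moment of [rho] is the probability that two independent positions of v give the same
   vector, and this forces equal [tau] to every neighbour of v in S. *)
have sqE x : \sum_xi rho x xi ^+ 2 <= \sum_t \sum_t' mu t * mu t' *
    [forall (u | B u), tau t (x u) == tau t' (x u)]%:R.
  apply: le_trans (_ : \sum_t \sum_t' mu t * mu t' * (dv x t == dv x t')%:R <= _).
    under eq_bigr do rewrite expr2 big_distrlr/=.
    rewrite exchange_big/=; apply: ler_sum => t _; rewrite exchange_big/=; apply: ler_sum => t' _.
    rewrite (bigD1 (dv x t))//= eqxx mulr1 big1 ?addr0; last first.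
      by move=> xi; rewrite eq_sym => /negbTE ->; rewrite mulr0 mul0r.
    by rewrite mulrA [dv x t' == _]eq_sym.
  apply: ler_sum => t _; apply: ler_sum => t' _; rewrite ler_wpM2l ?mulr_ge0// ler_nat.
  case: eqP => // E; suff -> : [forall (u | B u), tau t (x u) == tau t' (x u)] by [].
  apply/forallP => u; apply/implyP => /andP[uS evu].
  have uv : u != v by apply: contraTneq evu => ->; rewrite ei.
  have [uv'|uv'] := ltnP u v.
    have /ffunP/(_ (u, v)) := E; rewrite !ffunE /edges_in /edge_of/= uv' es evu uS vS/=.
    by rewrite eqxx (negbTE uv) => -[]; rewrite tauC [in RHS]tauC => ->.
  have vu : (v < u)%N by rewrite ltn_neqAle eq_sym uv.
  have /ffunP/(_ (v, u)) := E; rewrite !ffunE /edges_in /edge_of/= vu evu uS vS/=.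
  by rewrite eqxx (negbTE uv) => -[] ->.
rewrite /dist_prob (resampling _ v mu1).
apply: le_trans (_ : \sum_(x : {ffun 'I_n -> X}) (\prod_v mu (x v)) *
   ((N' (dist_vector tau S' x))%:R + L * th + lam^-1 * \sum_t \sum_t' mu t * mu t' *
    [forall (u | B u), tau t (x u) == tau t' (x u)]%:R) <= _).
  apply: ler_sum => x _; rewrite ler_wpM2l ?prodr_ge0//.
  apply: le_trans (pt x) _; rewrite lerD2l ler_wpM2l// invr_ge0 ltW//.
under eq_bigr do rewrite !mulrDr [_ * (lam^-1 * _)]mulrCA.
rewrite !big_split/= -mulr_suml sum_prod_ffun// mul1r -mulr_sumr.
rewrite -/(dist_prob mu tau S' N') -/(tau_energy mu tau B).
have e1 := IHv X T mu tau M M0 mu0 mu1 tauC en N' N'le.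
have e2 : L * th = eps / 3 by rewrite /th mulrC mulfVK// gt_eqF.
have e3 : lam^-1 * tau_energy mu tau B <= eps / 3.
  have := en B Bk; rewrite -/k' => enB.
  rewrite /lam invf_div mulrAC ler_pdivrMr// mulrC.
  apply: le_trans enB _; rewrite /L mulrDr mulr1.
  have -> : eps / 3 * (3 * C / eps) = C by field; rewrite gt_eqF.
  by rewrite lerDl ltW.
rewrite e2.
rewrite [leRHS](_ : eps = eps / 3 + eps / 3 + eps / 3); last by field.
by apply: lerD => //; apply: lerD.
Qed.

End GraphInduction.

(** * Greedy Frostman measure on the dyadic tree *)

Section GreedyFrostman.
Variables (R : realFieldType) (d m j0 : nat) (q : R).
Local Notation X := {ffun 'I_d -> 'I_(2 ^ m)}.
Variable h : pred X.
Hypothesis q0 : 0 < q.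
Hypothesis j0m : (j0 <= m)%N.

(** The level l cell containing x, of side 2 ^ (m - l). Its index is kept in the type of the leaves,
    so that cells of all levels have one type. *)
Definition ancestor (l : nat) (x : X) : X :=
  [ffun i => Ordinal (leq_ltn_trans (leq_div (x i) (2 ^ (m - l))) (ltn_ord (x i)))].

Lemma ancestorE l x i : ancestor l x i = (x i %/ 2 ^ (m - l))%N :> nat.
Proof. by rewrite ffunE. Qed.

Lemma ancestor_coarsen l l' x y : (l <= l')%N -> ancestor l' x = ancestor l' y ->
  ancestor l x = ancestor l y.
Proof.
move=> ll' /ffunP E; apply/ffunP => i; apply/val_inj => /=.
have := congr1 (@nat_of_ord _) (E i); rewrite !ffunE/= => {}E.
have [lm|lm] := leqP l' m; last first.
  have l0 : (m - l' = 0)%N by lia.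
  by move: E; rewrite l0 !divn1 => ->.
have -> : (m - l = (m - l') + (l' - l))%N by lia.
by rewrite expnD !divnMA E.
Qed.

Lemma ancestor_leaf x : ancestor m x = x.
Proof. by apply/ffunP => i; apply/val_inj; rewrite /= ffunE/= subnn divn1. Qed.

Definition cell_mass (mu : X -> R) (l : nat) (x : X) : R :=
  \sum_(y | ancestor l y == ancestor l x) mu y.

(* Going from fine to coarse levels, the mass of each cell that is too heavy is scaled
   down to the allowed value; the last scaling above a leaf leaves a saturated cell. *)
Lemma greedy_frostman_step r : (r <= m)%N -> exists mu : X -> R,
  [/\ forall x, 0 <= mu x, forall x, mu x != 0 -> h x,
      forall l x, (m - r <= l <= m)%N -> cell_mass mu l x <= q ^+ l &
      forall x, h x -> exists2 l, (m - r <= l <= m)%N & q ^+ l <= cell_mass mu l x].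
Proof.
elim: r => [_|r IH rm].
  exists (fun x => if h x then q ^+ m else 0); split => [x|x|l x|x hx].
  - by case: ifP => // _; rewrite exprn_ge0// ltW.
  - by case: ifP => //; rewrite eqxx.
  - rewrite subn0 -eqn_leq => /eqP <-; rewrite /cell_mass (big_pred1 x).
      by case: ifP => // _; rewrite exprn_ge0// ltW.
    by move=> y /=; rewrite !ancestor_leaf.
  exists m; first by rewrite subn0 leqnn.
  rewrite /cell_mass (big_pred1 x) ?hx// => y /=.
  by rewrite !ancestor_leaf.
have [mu [mu0 muh mule muge]] := IH (ltnW rm).
set j := (m - r.+1)%N.
pose f x := if cell_mass mu j x <= q ^+ j then 1 else q ^+ j / cell_mass mu j x.
have qj : 0 < q ^+ j by rewrite exprn_gt0.
have mass0 l x : 0 <= cell_mass mu l x by apply: sumr_ge0.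
have f0 x : 0 <= f x by rewrite /f; case: ifP => // _; rewrite divr_ge0// ltW.
have f1 x : f x <= 1.
  rewrite /f; case: (leP (cell_mass mu j x)) => // H.
  by rewrite ler_pdivrMr ?mul1r ?ltW// (lt_trans qj).
have fE x y : ancestor j x = ancestor j y -> f x = f y.
  by move=> E; rewrite /f /cell_mass E.
have massE l x : (j <= l)%N -> cell_mass (fun x => mu x * f x) l x = cell_mass mu l x * f x.
  move=> jl; rewrite /cell_mass mulr_suml; apply: eq_bigr => y /eqP E.
  by rewrite (fE y x)//; apply: ancestor_coarsen jl E.
exists (fun x => mu x * f x); split => [x|x|l x|x hx].
- by rewrite mulr_ge0.
- by rewrite mulf_eq0 negb_or => /andP[/muh].
- case/andP=> jl lm; rewrite massE//.
  have [lj|lj] := eqVneq l j; last first.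
    rewrite -[leRHS]mulr1 ler_pM// mule// lm andbT.
    by move: jl lj; rewrite /j; lia.
  rewrite lj /f; case: (leP (cell_mass mu j x)) => H; first by rewrite mulr1.
  by rewrite mulrC mulfVK// gt_eqF// (lt_trans qj).
have [l /andP[jl lm] lge] := muge x hx.
have [H|H] := leP (cell_mass mu j x) (q ^+ j).
  exists l; first by rewrite lm andbT; move: jl; rewrite /j; lia.
  by rewrite massE ?/f ?H ?mulr1//; move: jl; rewrite /j; lia.
exists j; first by rewrite leqnn leq_subr.
by rewrite massE// /f (leNgt (cell_mass mu j x) (q ^+ j)) H/= mulrC mulfVK// gt_eqF// (lt_trans qj).
Qed.

(** [Cov] consists of the coarsest saturated cell above each leaf of [h]. These cells are pairwise
    disjoint, so the sum of their saturated masses is at most the total mass; since they cover [h],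
    this bounds the total mass below by a Hausdorff sum. *)
Lemma greedy_frostman : exists mu : X -> R, exists Cov : pred ('I_m.+1 * X),
  [/\ forall x, 0 <= mu x /\ (mu x != 0 -> h x),
      forall l x, (j0 <= l <= m)%N -> cell_mass mu l x <= q ^+ l,
      (forall x, h x -> exists l : 'I_m.+1, Cov (l, ancestor l x)),
      (forall p, Cov p -> (j0 <= p.1)%N) &
      \sum_(p | Cov p) q ^+ p.1 <= \sum_x mu x].
Proof.
have [mu] := greedy_frostman_step (leq_subr j0 m); rewrite subKn// => -[mu0 muh mule muge].
pose sat x l := (j0 <= l)%N && (q ^+ l <= cell_mass mu l x).
have satE l x y : ancestor l x = ancestor l y -> sat x l = sat y l.
  by move=> E; rewrite /sat /cell_mass E.
pose Cov (p : 'I_m.+1 * X) := [exists x, [&& h x, sat x p.1, ancestor p.1 x == p.2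
  & [forall l : 'I_m.+1, (l < p.1)%N ==> ~~ sat x l]]].
exists mu, Cov; split => //.
- by move=> x; split => //; exact: muh.
- move=> x hx; have [l /andP[jl lm] lge] := muge x hx.
  have sl : sat x (Ordinal (lm : (l < m.+1)%N)) by rewrite /sat jl.
  case: (@arg_minnP _ _ (fun l : 'I_m.+1 => sat x l) (@nat_of_ord _) sl) => i si imin.
  exists i; apply/existsP; exists x; rewrite hx/= si eqxx/=.
  apply/forallP => l'; apply/implyP; rewrite ltnNge; apply: contra; exact: imin.
- by move=> p /existsP[x /and4P[_ /andP[]]].
apply: le_trans (_ : \sum_(p | Cov p) \sum_(y | ancestor p.1 y == p.2) mu y <= _).
  apply: ler_sum => p /existsP[x /and4P[_ /andP[_ sx] /eqP <- _]].
  exact: sx.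
under eq_bigr do rewrite big_mkcond/=.
rewrite exchange_big/=; apply: ler_sum => y _.
rewrite -big_mkcondr/=.
have [p0 /andP[Cp0 p0y]|none] := pickP (fun p : 'I_m.+1 * X => Cov p && (ancestor p.1 y == p.2)).
  rewrite (bigD1 p0) ?Cp0//= big1 ?addr0// => p /andP[/andP[Cp py] pp0].
  case/eqP: pp0.
  (* If a strictly coarser chosen cell contained a chosen cell, it would be a coarser saturated
     ancestor of the leaf that witnesses the finer one. *)
  have aux (a b : 'I_m.+1 * X) : Cov a -> Cov b -> ancestor a.1 y == a.2 ->
    ancestor b.1 y == b.2 -> ~~ (a.1 < b.1)%N.
    move=> /existsP[x /and4P[_ sx /eqP xa _]] /existsP[x' /and4P[_ _ /eqP xb /forallP minx']].
    move=> /eqP ya /eqP yb; apply/negP => ab; have /implyP/(_ ab)/negP := minx' a.1; apply.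
    rewrite (satE _ _ x)// xa -ya; apply: ancestor_coarsen (ltnW ab) _.
    by rewrite xb yb.
  have e1 : p.1 = p0.1.
    apply/val_inj/eqP; rewrite /= eqn_leq leqNgt (aux p0 p)//= leqNgt (aux p p0)//.
  have e2 : p.2 = p0.2 by rewrite -(eqP py) -(eqP p0y) e1.
  by case: p p0 e1 e2 {Cp py Cp0 p0y} => [a b] [a' b'] /= -> ->.
by rewrite big_pred0.
Qed.

End GreedyFrostman.

(** * The Euclidean norm *)

Section Euclidean.
Variables (R : realType) (d : nat).
Implicit Types x y z : 'rV[R]_d.

Lemma cauchy_schwarz_sum (f g : 'I_d -> R) :
  (\sum_i f i * g i) ^+ 2 <= (\sum_i f i ^+ 2) * (\sum_i g i ^+ 2).
Proof.
have : 0 <= \sum_i \sum_j (f i * g j - f j * g i) ^+ 2.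
  by apply: sumr_ge0 => i _; apply: sumr_ge0 => j _; rewrite sqr_ge0.
have -> : \sum_i \sum_j (f i * g j - f j * g i) ^+ 2 =
   ((\sum_i f i ^+ 2) * (\sum_i g i ^+ 2) - (\sum_i f i * g i) ^+ 2) *+ 2.
  transitivity (\sum_i \sum_j (f i ^+ 2 * g j ^+ 2 + g i ^+ 2 * f j ^+ 2
     - (f i * g i) * (f j * g j) *+ 2)).
    by apply: eq_bigr => i _; apply: eq_bigr => j _; ring.
  under eq_bigr do rewrite sumrB big_split/= -!mulr_sumr sumrMnl -mulr_sumr.
  rewrite sumrB big_split/= -!mulr_suml sumrMnl -mulr_suml; ring.
by rewrite pmulrn_lge0// subr_ge0.
Qed.

Lemma enorm_ge0 x : 0 <= enorm x. Proof. exact: sqrtr_ge0. Qed.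

Lemma sqr_enorm x : enorm x ^+ 2 = \sum_i x ord0 i ^+ 2.
Proof. by rewrite sqr_sqrtr// sumr_ge0// => i _; rewrite sqr_ge0. Qed.

Lemma enormD x y : enorm (x + y) <= enorm x + enorm y.
Proof.
rewrite -(ler_pXn2r (isT : 0 < 2)%N) ?nnegrE ?addr_ge0 ?enorm_ge0// sqrrD !sqr_enorm.
have -> : \sum_i (x + y) ord0 i ^+ 2 = \sum_i x ord0 i ^+ 2
   + (\sum_i x ord0 i * y ord0 i) *+ 2 + \sum_i y ord0 i ^+ 2.
  rewrite -sumrMnl -!big_split/=; apply: eq_bigr => i _; rewrite mxE; ring.
rewrite lerD2r lerD2l lerMn2r/=.
apply: le_trans (ler_norm _) _.
rewrite -(ler_pXn2r (isT : 0 < 2)%N) ?nnegrE ?mulr_ge0 ?enorm_ge0// exprMn !sqr_enorm.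
by rewrite real_normK ?num_real// cauchy_schwarz_sum.
Qed.

Lemma enormN x : enorm (- x) = enorm x.
Proof. by congr Num.sqrt; apply: eq_bigr => i _; rewrite mxE sqrrN. Qed.

Lemma edistC x y : edist x y = edist y x.
Proof. by rewrite /edist -enormN opprB. Qed.

Lemma ler_dist_enorm x y : `|enorm x - enorm y| <= enorm (x - y).
Proof.
rewrite ler_norml; apply/andP; split.
  by rewrite lerNl opprB lerBlDr -(enormN (x - y)) opprB (le_trans _ (enormD _ _))// subrK.
by rewrite lerBlDr (le_trans _ (enormD _ _))// subrK.
Qed.

Lemma enorm_le x t : 0 <= t -> (forall i, `|x ord0 i| <= t) -> enorm x <= d%:R * t.
Proof.
move=> t0 xt.
rewrite -(ler_pXn2r (isT : 0 < 2)%N) ?nnegrE ?mulr_ge0 ?enorm_ge0// sqr_enorm.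
apply: le_trans (_ : \sum_(i < d) t ^+ 2 <= _).
  apply: ler_sum => i _; rewrite -real_normK ?num_real// lerXn2r ?nnegrE//.
rewrite sumr_const card_ord exprMn -[leLHS]mulr_natl.
by apply: ler_wpM2r; rewrite ?sqr_ge0// -natrX ler_nat; case: (d) => // d'; rewrite -mulnn leq_pmulr.
Qed.

End Euclidean.

(** * Points of a cube and their dyadic cells *)

Section DyadicCells.
Variables (R : realType) (d : nat) (b : R).
Hypothesis b0 : 0 < b.
Local Notation lam m := ((2 ^ m)%:R / (2 * b)).
Implicit Types x y : 'rV[R]_d.

Definition bounded_by x := forall i, `|x ord0 i| < b.

(* The index of the cell of side 2 b / 2 ^ m containing x; the reduction modulo
   2 ^ m only makes this total, it is trivial when x is bounded by b. *)
Definition dyadic_cell (m : nat) x : {ffun 'I_d -> 'I_(2 ^ m)} :=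
  [ffun i => Ordinal (ltn_pmod (Num.truncn (lam m * (x ord0 i + b))) (expn_gt0 2 m : (0 < 2 ^ m)%N))].

Lemma scale_gt0 m : 0 < lam m.
Proof. by rewrite divr_gt0 ?mulr_gt0 ?ltr0n ?expn_gt0. Qed.

Lemma dyadic_cellP m x i : bounded_by x ->
  (dyadic_cell m x i)%:R <= lam m * (x ord0 i + b) < (dyadic_cell m x i).+1%:R.
Proof.
move=> /(_ i); rewrite ltr_norml => /andP[xb1 xb2].
have u0 : 0 <= lam m * (x ord0 i + b).
  by rewrite mulr_ge0 ?(ltW (scale_gt0 m))// -lerBlDr sub0r ltW.
have u1 : lam m * (x ord0 i + b) < (2 ^ m)%:R.
  rewrite mulrAC ltr_pdivrMr ?mulr_gt0// ltr_pM2l ?ltr0n ?expn_gt0//.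
  by rewrite mulr_natl mulr2n ltrD2r.
rewrite ffunE/= modn_small ?truncn_itv//.
by rewrite truncn_lt_nat.
Qed.

Lemma edist_same_ancestor m l x y : (l <= m)%N -> bounded_by x -> bounded_by y ->
  ancestor l (dyadic_cell m x) = ancestor l (dyadic_cell m y) ->
  edist x y <= d%:R * (2 * b / (2 ^ l)%:R).
Proof.
move=> lm xb yb /ffunP E; apply: enorm_le => [|i].
  by rewrite divr_ge0 ?mulr_ge0// ltW.
rewrite !mxE.
have := congr1 (@nat_of_ord _) (E i); rewrite !ancestorE.
have := dyadic_cellP m i xb; have := dyadic_cellP m i yb.
move: (nat_of_ord _) (nat_of_ord _) => p p' /andP[p1 p2] /andP[p'1 p'2] pp.
set S := (2 ^ (m - l))%N in pp.
have S0 : (0 < S)%N by rewrite expn_gt0.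
have h1 : (p < p' + S)%N.
  have := divn_eq p S; have := divn_eq p' S; have := ltn_pmod p S0; have := ltn_pmod p' S0.
  rewrite pp; lia.
have h2 : (p' < p + S)%N.
  have := divn_eq p S; have := divn_eq p' S; have := ltn_pmod p S0; have := ltn_pmod p' S0.
  rewrite pp; lia.
have {}h1 : p.+1%:R <= p'%:R + S%:R :> R by rewrite -natrD ler_nat.
have {}h2 : p'.+1%:R <= p%:R + S%:R :> R by rewrite -natrD ler_nat.
have l0 := scale_gt0 m.
rewrite -(ler_pM2l l0).
have -> : lam m * (2 * b / (2 ^ l)%:R) = S%:R.
  have l1 : (2 ^ l)%:R != 0 :> R by rewrite pnatr_eq0 -lt0n expn_gt0.
  have b1 : b != 0 by rewrite gt_eqF.
  rewrite -{1}(subnKC lm) expnD natrM -/S; move: (2 ^ l)%:R S%:R l1 => u v u0.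
  by field; rewrite b1 u0.
rewrite -(ger0_norm (ltW l0)) -normrM ler_norml mulrBr.
move: p1 p2 p'1 p'2; rewrite !mulrDr; lra.
Qed.

Lemma sqrt_grid_sqdist m (p p' : {ffun 'I_d -> 'I_(2 ^ m)}) :
  Num.sqrt (grid_sqdist p p')%:R = enorm (\row_i ((p i)%:R - (p' i)%:R)) :> R.
Proof.
congr Num.sqrt; rewrite /grid_sqdist natr_sum; apply: eq_bigr => i _; rewrite mxE natrX.
have [pp|pp] := leqP (p i) (p' i).
  by rewrite (eqP pp) add0n natrB// -sqrrN opprB.
by rewrite (eqP (ltnW pp)) addn0 natrB// ltnW.
Qed.

(** Each rescaled coordinate exceeds its cell index by less than 1, so the rescaled difference
    vector and the difference of the indices are within 1 in every coordinate. *)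
Lemma edist_dyadic_cell m x y : bounded_by x -> bounded_by y ->
  `|lam m * edist x y - Num.sqrt (grid_sqdist (dyadic_cell m x) (dyadic_cell m y))%:R| <= d%:R.
Proof.
move=> xb yb; rewrite sqrt_grid_sqdist.
have -> : lam m * edist x y = enorm (lam m *: (x - y)).
  rewrite /edist /enorm.
  have -> : \sum_i (lam m *: (x - y)) ord0 i ^+ 2 = lam m ^+ 2 * \sum_i (x - y) ord0 i ^+ 2.
    by rewrite mulr_sumr; apply: eq_bigr => i _; rewrite [in LHS]mxE exprMn.
  by rewrite sqrtrM ?sqr_ge0// sqrtr_sqr (ger0_norm (ltW (scale_gt0 m))).
apply: le_trans (ler_dist_enorm _ _) _; rewrite -[leRHS]mulr1; apply: enorm_le => // i.
rewrite !mxE.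
have := dyadic_cellP m i xb; have := dyadic_cellP m i yb.
rewrite -!natr1 !mulrDr mulrN ler_norml; lra.
Qed.

Lemma sqrt_grid_sqdist_le m (p p' : {ffun 'I_d -> 'I_(2 ^ m)}) :
  Num.sqrt (grid_sqdist p p')%:R <= d%:R * (2 ^ m)%:R :> R.
Proof.
rewrite sqrt_grid_sqdist; apply: enorm_le => // i; rewrite mxE ler_norml.
have : (p i)%:R <= (2 ^ m)%:R :> R by rewrite ler_nat ltnW.
have : (p' i)%:R <= (2 ^ m)%:R :> R by rewrite ler_nat ltnW.
have : 0 <= (p i)%:R :> R by [].
have : 0 <= (p' i)%:R :> R by [].
lra.
Qed.

Lemma edist_bounded x y : bounded_by x -> bounded_by y -> edist x y <= d%:R * (2 * b).
Proof.
move=> xb yb; apply: enorm_le => [|i]; first by rewrite mulr_ge0// ltW.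
have := xb i; have := yb i; rewrite !mxE !ltr_norml ler_norml; lra.
Qed.

End DyadicCells.

(** * From Hausdorff dimension to discrete Frostman measures *)

Section Frostman.
Variables (R : realType) (d : nat).

Lemma hcov_term_ge0 (s : R) (U : set 'rV[R]_d) : (0 <= hcov_term s U)%E.
Proof. by rewrite /hcov_term; case: ifP => // _; rewrite lee_fin powR_ge0. Qed.

Lemma hausdorff_content_delta_ge0 (s delta : R) (E : set 'rV[R]_d) :
  (0 <= hausdorff_content_delta s delta E)%E.
Proof.
apply: le_ereal_inf_tmp => _ [U _ <-]; apply: nneseries_ge0 => i _ _.
exact: hcov_term_ge0.
Qed.

Lemma hausdorff_content_delta_le (I : finType) (i0 : I) (Q : pred I) (U : I -> set 'rV[R]_d)
    (w : I -> R) (s delta : R) (E : set 'rV[R]_d) :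
  E `<=` [set x | exists2 i, Q i & U i x] ->
  (forall i, Q i -> (ediam (U i) <= delta%:E)%E) ->
  (forall i, Q i -> (hcov_term s (U i) <= (w i)%:E)%E) ->
  (hausdorff_content_delta s delta E <= (\sum_(i | Q i) w i)%:E)%E.
Proof.
move=> EU Ud Uw.
pose es := enum Q.
(* The finite cover is padded with empty sets: their diameter is -oo and their cost is 0. *)
pose V k := if (k < size es)%N then U (nth i0 es k) else set0.
have esQ k : (k < size es)%N -> Q (nth i0 es k).
  by move=> kes; have := mem_nth i0 kes; rewrite mem_enum.
have -> : (\sum_(i | Q i) w i)%:E = (\sum_(0 <= k < size es) (w (nth i0 es k))%:E)%E.
  by rewrite sumEFin -(big_nth i0 xpredT)/= big_enum.
apply: (@le_trans _ _ (\sum_(0 <= k <oo) hcov_term s (V k))%E).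
  apply: ereal_inf_lbound; exists V => //; split => [x /EU[i Qi Uix]|k].
    have ies : i \in es by rewrite mem_enum.
    by exists (index i es) => //; rewrite /V index_mem ies nth_index.
  rewrite /V; case: ifP => [kes|_]; first exact/Ud/esQ.
  rewrite /ediam (_ : [set _ | _ in _ & _ in _] = set0) ?ereal_sup0 ?leNye//.
  by rewrite -subset0 => z [x []].
rewrite (nneseries_split 0 (size es)); last by move=> k _; exact: hcov_term_ge0.
rewrite add0n [X in (_ + X)%E]eseries0 ?adde0.
  rewrite !big_nat; apply: lee_sum => k /= kes; rewrite /V kes.
  exact/Uw/esQ.
by move=> k kes _; rewrite /V ltnNge kes/= /hcov_term asboolT.
Qed.

Lemma content_gt0_of_lt_dim (s : R) (E : set 'rV[R]_d) : 0 <= s -> s < hausdorff_dim E ->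
  exists delta c : R, [/\ 0 < delta, 0 < c & (c%:E <= hausdorff_content_delta s delta E)%E].
Proof.
move=> s0 sE.
have : hausdorff_measure s E != 0%E.
  apply: contraTneq sE => H; rewrite -leNgt; apply: ge_inf => //.
  by exists 0 => t [].
have H0 : (0 <= hausdorff_measure s E)%E.
  apply: le_trans (hausdorff_content_delta_ge0 s 1 E) _.
  by apply: ereal_sup_ubound; exists 1 => /=.
rewrite neq_lt ltNge H0/= => /ereal_sup_gt[_ [delta delta0 <-]].
case C : hausdorff_content_delta => [c| |]//.
  by rewrite lte_fin => c0; exists delta, c; rewrite C.
(* The content may be infinite, and then any positive constant serves. *)
by move=> _; exists delta, 1; rewrite C leey.
Qed.

Variables (b : R).
Hypothesis b0 : 0 < b.

Lemma hcov_term_cell (s : R) (l m : nat) (U : set 'rV[R]_d) (c : {ffun 'I_d -> 'I_(2 ^ m)}) :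
  0 <= s -> (l <= m)%N -> (forall x, U x -> bounded_by b x) ->
  (forall x, U x -> ancestor l (dyadic_cell b m x) = c) ->
  (ediam U <= ((d%:R * (2 * b) + 1) / (2 ^ l)%:R)%:E)%E /\
  (hcov_term s U <= ((d%:R * (2 * b) + 1) `^ s * (2 `^ (- s)) ^+ l)%:E)%E.
Proof.
(* The + 1 keeps D positive even for d = 0. *)
move=> s0 lm Ub Uc; set D := d%:R * (2 * b) + 1.
have D0 : 0 < D by rewrite ltr_wpDl// mulr_ge0// mulr_ge0// ltW.
have p0 : 0 < (2 ^ l)%:R :> R by rewrite ltr0n expn_gt0.
have diam : (ediam U <= (D / (2 ^ l)%:R)%:E)%E.
  apply: ge_ereal_sup => _ [x Ux [y Uy <-]]; rewrite lee_fin.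
  apply: le_trans (edist_same_ancestor b0 lm (Ub _ Ux) (Ub _ Uy) _) _.
    by rewrite (Uc _ Ux) (Uc _ Uy).
  by rewrite mulrA ler_wpM2r ?invr_ge0 ?(ltW p0)// /D lerDl.
split => //.
rewrite /hcov_term; case: ifPn => [_|/asboolP/eqP/set0P[x Ux]].
  by rewrite lee_fin mulr_ge0 ?powR_ge0// exprn_ge0// powR_ge0.
have diam0 : (0 <= ediam U)%E.
  apply: ereal_sup_ubound; exists x => //; exists x => //.
  rewrite /edist subrr /enorm big1 ?sqrtr0// => i _.
  by rewrite mxE expr0n.
have fin : ediam U \is a fin_num by rewrite ge0_fin_numE// (le_lt_trans diam) ?ltry.
have fd : fine (ediam U) <= D / (2 ^ l)%:R by rewrite -lee_fin fineK.
rewrite lee_fin; apply: le_trans (ge0_ler_powR s0 _ _ fd) _.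
- by rewrite nnegrE fine_ge0.
- by rewrite nnegrE divr_ge0// ltW.
rewrite powRM ?invr_ge0 ?(ltW D0) ?(ltW p0)//.
have -> : (2 ^ l)%:R^-1 `^ s = (2 `^ (- s)) ^+ l :> R; last exact: lexx.
rewrite natrX -[2 ^+ l]powR_mulrn// -[_^-1]powR_inv1 ?powR_ge0// -!powRrM.
by rewrite -powR_mulrn ?powR_ge0// -powRrM; congr (_ `^ _); ring.
Qed.

Lemma ediam_cell_scale (D delta : R) : 0 < D -> 0 < delta -> exists j0 : nat,
  forall l, (j0 <= l)%N -> D / (2 ^ l)%:R <= delta.
Proof.
move=> D0 delta0; exists (Num.truncn (D / delta)).+1 => l jl.
rewrite ler_pdivrMr ?ltr0n ?expn_gt0// mulrC -ler_pdivrMr//.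
apply/ltW/(lt_le_trans (truncnS_gt _)); rewrite ler_nat.
by apply: leq_trans jl _; apply/ltnW/ltn_expl.
Qed.

(** The selected cells of [greedy_frostman] cover E with diameters at most delta, so positivity of
    the Hausdorff content bounds the total mass below independently of m. Normalizing therefore
    preserves the decay with constants uniform in m. *)
Lemma frostman (s : R) (E : set 'rV[R]_d) : 0 < s -> s < hausdorff_dim E ->
  (forall x, E x -> bounded_by b x) ->
  exists (A0 : R) (m0 : nat), 0 <= A0 /\ forall m, (m0 <= m)%N ->
  exists mu : {ffun 'I_d -> 'I_(2 ^ m)} -> R,
   [/\ forall p, 0 <= mu p, \sum_p mu p = 1,
       forall p, mu p != 0 -> exists2 x, E x & dyadic_cell b m x = p &
       forall j, (j <= m)%N -> forall c : 'I_d -> nat,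
         \sum_(p : {ffun 'I_d -> 'I_(2 ^ m)} | [forall i, p i %/ 2 ^ (m - j) == c i]%N) mu p
           <= A0 * (2 `^ (- s)) ^+ j].
Proof.
move=> s0 sE Eb.
have [delta [c [delta0 c0 cE]]] := content_gt0_of_lt_dim (ltW s0) sE.
set D := d%:R * (2 * b) + 1.
have D0 : 0 < D by rewrite ltr_wpDl// mulr_ge0// mulr_ge0// ltW.
have [j0 j0P] := ediam_cell_scale D0 delta0.
set q := 2 `^ (- s).
have q0 : 0 < q by rewrite powR_gt0.
have q1 : q <= 1 by rewrite -(powRr0 2) ler_powR ?ler1n// oppr_le0 ltW.
have Ds0 : 0 < D `^ s by rewrite powR_gt0.
pose c1 := c / D `^ s.
have c10 : 0 < c1 by rewrite divr_gt0.
(* For j >= j0 the mass is at most q ^ j / tot <= q ^ j / c1; for j < j0 the trivial bound 1 is at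
   most q ^ (- j0) q ^ j. *)
exists (c1^-1 + q ^- j0), j0; split; first by rewrite addr_ge0 ?invr_ge0 ?exprn_ge0 ?ltW.
move=> m j0m.
pose h : pred {ffun 'I_d -> 'I_(2 ^ m)} := fun p => `[< exists2 x, E x & dyadic_cell b m x = p >].
have [mu [Cov [muh mule covh covj Covsum]]] := greedy_frostman h q0 j0m.
have mu0 p : 0 <= mu p by have [] := muh p.
set tot := \sum_x mu x in Covsum.
have c1tot : c1 <= tot.
  apply: le_trans Covsum; rewrite ler_pdivrMr// -lee_fin; apply: le_trans cE _.
  pose U (p : 'I_m.+1 * {ffun 'I_d -> 'I_(2 ^ m)}) :=
    [set x | E x /\ ancestor p.1 (dyadic_cell b m x) = p.2].
  pose i0 : 'I_m.+1 * {ffun 'I_d -> 'I_(2 ^ m)} := (ord0, dyadic_cell b m 0).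
  rewrite mulrC mulr_sumr.
  have cell (p : 'I_m.+1 * {ffun 'I_d -> 'I_(2 ^ m)}) := @hcov_term_cell s p.1 m (U p) p.2 (ltW s0) (ltn_ord p.1 : (p.1 <= m)%N).
  apply: (@hausdorff_content_delta_le _ i0 Cov U).
  - move=> x Ex; have [|l Cl] := covh (dyadic_cell b m x).
      by apply/asboolP; exists x.
    by exists (l, ancestor l (dyadic_cell b m x)).
  - move=> p Cp; have [|x [_]//|+ _] := cell p; first by move=> x [/Eb].
    by move/le_trans; apply; rewrite lee_fin j0P// covj.
  - by move=> p Cp; have [|x [_]//|_ +] := cell p; first by move=> x [/Eb].
have tot0 : 0 < tot by apply: lt_le_trans c1tot.
exists (fun p => mu p / tot); split => [p||p|j jm cc].
- by rewrite divr_ge0// ltW.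
- by rewrite -mulr_suml divff// gt_eqF.
- by rewrite mulf_eq0 negb_or => /andP[mup _]; have [_ /(_ mup)/asboolP] := muh p.
rewrite -mulr_suml ler_pdivrMr//.
have [jj0|jj0] := leqP j0 j.
  have [p0 p0c|none] := pickP (fun p : {ffun 'I_d -> 'I_(2 ^ m)} =>
     [forall i, p i %/ 2 ^ (m - j) == cc i]%N); last first.
    by rewrite big_pred0// !mulr_ge0 ?addr_ge0 ?invr_ge0 ?exprn_ge0 ?ltW.
  apply: le_trans (_ : q ^+ j <= _).
    have := mule j p0; rewrite jj0 jm => /(_ isT); apply: le_trans.
    rewrite /cell_mass le_eqVlt; apply/orP; left; apply/eqP; apply: eq_bigl => p.
    apply/forallP/eqP => [pc|/ffunP pc i].
      apply/ffunP => i; apply/val_inj; rewrite /= !ffunE/=.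
      by rewrite (eqP (pc i)) (eqP (forallP p0c i)).
    have := congr1 (@nat_of_ord _) (pc i); rewrite !ffunE/= => ->.
    exact: (forallP p0c i).
  rewrite mulrAC -[leLHS]mul1r ler_wpM2r ?exprn_ge0 ?(ltW q0)//.
  rewrite mulrDl -[leLHS]addr0 lerD//.
    by rewrite mulrC ler_pdivlMr// mul1r.
  by rewrite mulr_ge0 ?invr_ge0 ?exprn_ge0 ?(ltW q0) ?(ltW tot0).
apply: le_trans (_ : tot <= _); first exact: ler_sum_sub.
rewrite -[leLHS]mul1r ler_wpM2r ?(ltW tot0)//.
rewrite mulrDl -[leLHS]add0r lerD//.
  by rewrite mulr_ge0 ?invr_ge0 ?exprn_ge0 ?(ltW c10) ?(ltW q0).
rewrite mulrC ler_pdivlMr ?exprn_gt0// mul1r.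
by rewrite ler_wiXn2l ?(ltW q0)// ltnW.
Qed.

End Frostman.

(** * Compactness and finite box covers *)

Section Covering.
Variables (R : realType) (d : nat).

Lemma compact_bounded_by (E : set 'rV[R]_d) : compact E ->
  exists2 b : R, 0 < b & forall x, E x -> bounded_by b x.
Proof.
move=> /compact_near_coveringP/(_ nat \oo (fun N x => bounded_by N%:R x) _)[x Ex|N _ EN].
  exists ([set y : 'rV[R]_d | forall i j, ball (x i j) 1 (y i j)],
          [set N | (Num.truncn (\sum_i `|x ord0 i|)).+2 <= N]%N) => /=.
    split; last by exists (Num.truncn (\sum_i `|x ord0 i|)).+2.
    apply: (@filterS _ _ _ (ball x 1)); last exact: nbhsx_ballx.
    by move=> y [].
  move=> [y N] /= [yx NN] i.
  have := yx ord0 i; rewrite /ball/= => yxi.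
  have h1 : `|y ord0 i| <= `|x ord0 i| + `|x ord0 i - y ord0 i|.
    by rewrite distrC -lerBlDl; apply: le_trans (lerB_dist _ _) _.
  have h2 : `|x ord0 i| <= \sum_i `|x ord0 i|.
    by rewrite (bigD1 i)//= lerDl sumr_ge0.
  have h3 := truncnS_gt (\sum_i `|x ord0 i|).
  have h4 : (Num.truncn (\sum_i `|x ord0 i|)).+1%:R + 1 <= N%:R :> R.
    by rewrite natr1 ler_nat.
  lra.
exists N.+1%:R => // x /(EN N (leqnn N)) xN i.
by apply: lt_trans (xN i) _; rewrite ltr_nat.
Qed.

Lemma edist_lipschitz (x y x' y' : 'rV[R]_d) :
  `|edist x y - edist x' y'| <= edist x x' + edist y y'.
Proof.
apply: le_trans (ler_dist_enorm _ _) _.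
rewrite (_ : x - y - (x' - y') = (x - x') + (y' - y)); last first.
  by apply/rowP => i; rewrite !mxE; ring.
by rewrite (le_trans (enormD _ _))// lerD2l -/(edist y' y) edistC.
Qed.

Variables (n : nat) (e : rel 'I_n) (E : set 'rV[R]_d).

Lemma finite_box_cover (a c : nat -> edge_type e -> R) (r : nat -> R) :
  compact E -> (forall j, 0 < r j) ->
  distance_set e E `<=` \bigcup_j box (a j) (c j) ->
  exists J, forall x : 'I_n -> 'rV[R]_d, (forall v, E (x v)) ->
    exists2 j, (j < J)%N & forall p : edge_type e,
      a j p - r j <= edist (x (val p).1) (x (val p).2) <= c j p + r j.
Proof.
move=> cE r0 cover.
have cK := @tychonoff 'I_n (fun=> 'rV[R]_d) (fun=> E) (fun=> cE).
pose P (J : nat) (x : prod_topology (fun _ : 'I_n => 'rV[R]_d)) := exists2 j, (j < J)%N &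
  forall p : edge_type e, a j p - r j <= edist (x (val p).1) (x (val p).2) <= c j p + r j.
have /compact_near_coveringP/(_ nat \oo P _)[x Kx|J _ JP] := cK.
  have [|j _ xj] := cover (fun p => edist (x (val p).1) (x (val p).2)).
    by exists x.
  (* Moving both endpoints changes a distance by at most 2 d rho, which is below r j; the + 1 covers
     d = 0. *)
  pose rho := r j / (2 * d%:R + 1).
  have d1 : 0 < 2 * d%:R + 1 :> R by rewrite ltr_wpDl// mulr_ge0.
  have rho0 : 0 < rho by rewrite divr_gt0.
  exists ([set y : prod_topology (fun _ : 'I_n => 'rV[R]_d) | forall i, ball (x i) rho (y i)],
    [set J | (j < J)%N]) => /=.
    split; last by exists j.+1.
    apply: (@filter_forall _ _ (fun i (y : prod_topology (fun _ : 'I_n => 'rV[R]_d)) =>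
      ball (x i) rho (y i)) (nbhs x) _) => i.
    apply: (@proj_continuous _ (fun=> 'rV[R]_d) i x).
    exact: nbhsx_ballx.
  move=> [y J] /= [yx jJ]; exists j => // p.
  have xy v : edist (x v) (y v) <= d%:R * rho.
    apply: enorm_le; first exact: ltW.
    move=> i; have [_ /(_ ord0 i)] := yx v.
    by rewrite /ball/= !mxE => /ltW.
  have := xj p => /=; move: (val p).1 (val p).2 => u v uv.
  have := edist_lipschitz (x u) (x v) (y u) (y v); have := xy u; have := xy v.
  have : d%:R * rho + d%:R * rho <= r j.
    rewrite /rho -mulrDl mulrA ler_pdivrMr// mulrC ler_pM2l ?r0//; lra.
  rewrite ler_norml; move: uv; lra.
by exists J => x Ex; exact: (JP J (leqnn J) x Ex).
Qed.

End Covering.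

(** * Counting grid points in thickened boxes *)

Section Counting.
Variable R : realType.

(** Lets every box, even a degenerate one, be thickened at an arbitrarily small cost in volume. *)
Lemma prodr_addr_le (I : Type) (s : seq I) (w : I -> R) : (forall i, 0 <= w i) ->
  exists2 K, 0 <= K & forall t, 0 <= t <= 1 ->
    \prod_(i <- s) (w i + t) <= \prod_(i <- s) w i + t * K.
Proof.
move=> w0; elim: s => [|i s [K K0 IH]].
  by exists 0 => // t _; rewrite !big_nil mulr0 addr0.
have P0 : 0 <= \prod_(j <- s) w j by rewrite prodr_ge0.
exists (\prod_(j <- s) w j + w i * K + K) => [|t /andP[t0 t1]].
  by rewrite !addr_ge0// mulr_ge0.
rewrite !big_cons; apply: le_trans (ler_wpM2l _ (IH t _)) _; rewrite ?addr_ge0 ?t0//.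
move: (w0 i) P0; move: (w i) (\prod_(_ <- _) _) => u Q u0 Q0.
have : 0 <= t * (K * (1 - t)) by rewrite !mulr_ge0// subr_ge0.
lra.
Qed.

Lemma card_ord_itv_le (K : nat) (a c : R) : 0 <= c - a + 1 ->
  #|[pred t : 'I_K | a <= t%:R <= c]|%:R <= c - a + 1.
Proof.
move=> ac.
rewrite -sum1_card big_mkcond/=.
(* The extra bound K - a drives the induction: when t = K is counted, K <= c turns it into the bound
   by c - a + 1. *)
suff [->|[//]] : (\sum_(t < K) if t \in [pred t : 'I_K | (a <= t%:R <= c)%R] then 1 else 0)%N = 0%N \/
    (\sum_(t < K) if t \in [pred t : 'I_K | (a <= t%:R <= c)%R] then 1 else 0)%N%:R <= c - a + 1 /\
    (\sum_(t < K) if t \in [pred t : 'I_K | (a <= t%:R <= c)%R] then 1 else 0)%N%:R <= K%:R - a.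
  by [].
elim: K => [|K IH]; first by left; rewrite big_ord0.
rewrite big_ord_recr/=; move: IH; rewrite /in_mem/=.
move: (\sum_(i < K) _)%N => S IH; rewrite !natrD -natr1.
case: ifP => [/andP[aK Kc]|_]; rewrite ?addn0 ?addr0.
  by right; case: IH => [->|[S1 S2]]; lra.
by case: IH => [->|[S1 S2]]; [left|right; lra].
Qed.

End Counting.

Section BoxCounting.
Variable R : realType.

Lemma card_family_le (I : finType) (K J : nat) (A : pred I) (lo hi : 'I_J -> I -> R) :
  (forall j p, 0 <= hi j p - lo j p + 1) ->
  #|[pred xi : {ffun I -> option 'I_K} | [exists j, [forall p,
      if A p then (if xi p is Some t then lo j p <= t%:R <= hi j p else false)
      else xi p == None]]]|%:R
  <= \sum_j \prod_(p | A p) (hi j p - lo j p + 1).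
Proof.
move=> lohi.
pose F j p : pred (option 'I_K) := if A p
  then [pred o : option 'I_K | if o is Some t then lo j p <= t%:R <= hi j p else false]
  else pred1 None.
apply: le_trans (_ : \sum_j \sum_(xi | xi \in family (F j)) 1 <= _); last first.
  apply: ler_sum => j _.
  rewrite sumr_const card_family foldrE big_map big_enum/= natr_prod [leRHS]big_mkcond/=.
  apply: ler_prod => p _; rewrite ler0n/= /F; case: ifP => Ap; last by rewrite card1.
  apply: le_trans (card_ord_itv_le K (lohi j p)); rewrite ler_nat.
  set c := [pred t : 'I_K | _].
  apply: leq_trans (_ : #|[seq Some t | t in c]| <= _)%N; last exact: leq_image_card.
  apply/subset_leq_card/fintype.subsetP => -[t|]//= tc.
  by apply/fintype.imageP; exists t.
rewrite -sumr_const; apply: ler_sum_cover => // xi /existsP[j /forallP H].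
by exists j; apply/familyP => p; have := H p; rewrite /F; case: ifP.
Qed.

Lemma prod_edges (n : nat) (e : rel 'I_n) (F : 'I_n * 'I_n -> R) :
  \prod_(p | edge_of e p) F p = \prod_(i : edge_type e) F (val i).
Proof.
rewrite (reindex_omap (val : edge_type e -> _) insub); last first.
  by move=> p ep; rewrite insubT.
by apply: eq_bigl => -[p ep]/=; rewrite ep insubT/= eqxx.
Qed.

(** As lam r_j >= 2, the rounding term 2 is absorbed by a third r_j, so each factor is at most lam
    (w + 3 r_j). The volumes then sum to at most eps, and the thickening costs at most another eps
    in total. *)
Lemma scale_cover_le (n : nat) (e : rel 'I_n) (J : nat) (w : nat -> edge_type e -> R)
    (v : nat -> R) (r : nat -> R) (lam eps : R) : 0 < lam -> (forall j, 0 < r j) ->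
  (forall j, (j < J)%N -> 2 <= lam * r j) ->
  (forall j i, 0 <= w j i) ->
  (forall j, \prod_i (w j i + 3 * r j) <= v j + eps / (2 ^ j.+1)%:R) ->
  0 < eps -> (forall N, \sum_(j < N) v j <= eps) ->
  \sum_(j < J) \prod_(i : edge_type e) (lam * (w j i + 2 * r j) + 2)
    <= lam ^+ #|edge_type e| * (eps *+ 2).
Proof.
move=> lam0 r0 lamr w0 wv eps0 veps.
apply: le_trans (_ : \sum_(j < J) lam ^+ #|edge_type e| * (v j + eps / (2 ^ j.+1)%:R) <= _).
  apply: ler_sum => j _; rewrite -prodr_const.
  apply: le_trans (ler_wpM2l _ (wv j)); last by rewrite prodr_ge0// => i _; exact: ltW.
  rewrite -big_split/=; apply: ler_prod => i _; apply/andP; split.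
    by rewrite addr_ge0// mulr_ge0 ?(ltW lam0)// addr_ge0// mulr_ge0// ltW.
  have := lamr j (ltn_ord j); lra.
rewrite -mulr_sumr ler_wpM2l ?exprn_ge0 ?(ltW lam0)// big_split/= mulr2n lerD ?veps//.
rewrite -mulr_sumr -[leRHS]mulr1 ler_wpM2l ?(ltW eps0)//.
suff -> : \sum_(j < J) (2 ^ j.+1)%:R^-1 = 1 - (2 ^ J)%:R^-1 :> R.
  by rewrite lerBlDr lerDl invr_ge0.
elim: J {lamr} => [|J IH]; first by rewrite big_ord0 expn0 invr1 subrr.
rewrite big_ord_recr/= IH expnS natrM.
have p0 : (2 ^ J)%:R != 0 :> R by rewrite pnatr_eq0 -lt0n expn_gt0.
by move: (2 ^ J)%:R p0 => u u0; field.
Qed.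

End BoxCounting.

(** * Quantized distances between representatives in E *)

Section TauEnergy.
Variables (R : realType) (d m n : nat) (b : R).
Hypothesis b0 : 0 < b.
Local Notation X := {ffun 'I_d -> 'I_(2 ^ m)}.
Local Notation lam := ((2 ^ m)%:R / (2 * b)).
Variables (mu : X -> R) (pt : X -> 'rV[R]_d).
Hypothesis mu0 : forall x, 0 <= mu x.
Hypothesis ptb : forall x, mu x != 0 -> bounded_by b (pt x) /\ dyadic_cell b m (pt x) = x.

(** Distances are taken between points of E representing the cells, not between grid points, so that
    distance vectors of configurations come from [distance_set]. On the support of mu the rounded
    value is at most d 2 ^ m, so [inord] does not fall back to its default. *)
Definition quantized_dist (x y : X) : 'I_(d * 2 ^ m).+1 :=
  inord (Num.truncn (lam * edist (pt x) (pt y))).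

Lemma quantized_distP x y : mu x != 0 -> mu y != 0 ->
  (quantized_dist x y)%:R <= lam * edist (pt x) (pt y) < (quantized_dist x y)%:R + 1.
Proof.
move=> /ptb[xb _] /ptb[yb _].
have u0 : 0 <= lam * edist (pt x) (pt y).
  by rewrite mulr_ge0 ?enorm_ge0// ltW// scale_gt0.
rewrite /quantized_dist inordK; first by rewrite natr1 truncn_itv.
rewrite ltnS -(ler_nat R); apply: (@le_trans _ _ (lam * edist (pt x) (pt y))).
  by rewrite truncn_le.
apply: le_trans (ler_wpM2l _ (edist_bounded b0 xb yb)) _.
  exact/ltW/scale_gt0.
by rewrite mulrCA natrM mulfVK// mulf_neq0 ?gt_eqF.
Qed.

(** Equal quantized distances give grid distances u, u' with u - u' <= 2 d + 1 (two cell errors and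
    one rounding) and u + u' <= 2 d 2 ^ m; the product bounds the difference of squares. *)
Definition quantization_slack := ((2 * d + 1) * (2 * d))%N.

Lemma grid_sqdist_of_quantized x x' y : mu x != 0 -> mu x' != 0 -> mu y != 0 ->
  quantized_dist x y = quantized_dist x' y ->
  (grid_sqdist x y <= grid_sqdist x' y + quantization_slack * 2 ^ m)%N.
Proof.
move=> x0 x'0 y0 tE.
have [xb xE] := ptb x0; have [x'b x'E] := ptb x'0; have [yb yE] := ptb y0.
have := edist_dyadic_cell b0 m x'b yb; rewrite x'E yE ler_norml => /andP[g1 g2].
have := edist_dyadic_cell b0 m xb yb; rewrite xE yE ler_norml => /andP[g3 g4].
have /andP[t1 t2] := quantized_distP x0 y0.
have /andP[t3 t4] := quantized_distP x'0 y0; rewrite -tE in t3 t4.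
have uM := sqrt_grid_sqdist_le R x y; have u'M := sqrt_grid_sqdist_le R x' y.
have e1 : (grid_sqdist x y)%:R = Num.sqrt (grid_sqdist x y)%:R ^+ 2 :> R by rewrite sqr_sqrtr.
have e2 : (grid_sqdist x' y)%:R = Num.sqrt (grid_sqdist x' y)%:R ^+ 2 :> R by rewrite sqr_sqrtr.
rewrite -(ler_nat R) natrD !natrM natrD natrM e1 e2.
have u0 := sqrtr_ge0 ((grid_sqdist x y)%:R : R).
have u'0 := sqrtr_ge0 ((grid_sqdist x' y)%:R : R).
set u := Num.sqrt (grid_sqdist x y)%:R in g3 g4 uM u0 *.
set u' := Num.sqrt (grid_sqdist x' y)%:R in g1 g2 u'M u'0 *.
have k1 : u - u' <= 2 * d%:R + 1 by lra.
have k2 : u + u' <= 2 * d%:R * (2 ^ m)%:R by lra.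
have [k|k] := leP u u'.
  apply: (@le_trans _ _ (u' ^+ 2)); first by rewrite lerXn2r.
  by rewrite lerDl !mulr_ge0// addr_ge0// mulr_ge0.
rewrite -lerBlDl subr_sqr -mulrA ler_pM// ?subr_ge0 ?(ltW k)//.
by rewrite addr_ge0.
Qed.

Lemma tau_energy_le (B : pred 'I_n) :
  tau_energy mu quantized_dist B <= energy mu B (quantization_slack * 2 ^ m).
Proof.
apply: ler_sum => y _.
(* Representatives are controlled only on the support of mu, so terms of weight zero are discarded
   first. *)
have [/eqP/prodf_eq0[v _ /eqP yv]|/prodf_neq0 yn0] := eqVneq (\prod_v mu (y v)) 0.
  by rewrite (bigD1 v)//= yv !mul0r.
rewrite ler_wpM2l ?prodr_ge0//; apply: ler_sum => x _; apply: ler_sum => x' _.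
have [->|x0] := eqVneq (mu x) 0; first by rewrite !mul0r.
have [->|x'0] := eqVneq (mu x') 0; first by rewrite !mulr0 !mul0r.
rewrite ler_wpM2l ?mulr_ge0// ler_nat; case: forallP => // H.
suff -> : near_equidistant (quantization_slack * 2 ^ m) B y x x' by [].
apply/forallP => u; apply/implyP => Bu; have /implyP/(_ Bu)/eqP tE := H u.
by rewrite !grid_sqdist_of_quantized// yn0.
Qed.

End TauEnergy.

(** * A null distance set contradicts the probability estimate *)

Theorem theorem1p2 (R : realType) (n : nat) (e : rel 'I_n) (k : nat) :
  simple_graph e ->
  (1 <= #|edge_type e|)%N ->
  k_degenerate e k ->
  forall (d : nat) (E : set 'rV[R]_d),
    (k < d)%N ->
    compact E ->
    hausdorff_dim E > (d%:R + k%:R) / 2 ->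
    (0 < lebesgue_outer (distance_set e E))%E.
Proof.
move=> sg _ [deg _] d E kd cE sdim; have [es _] := sg.
rewrite ltNge; apply/negP => le0.
have [b b0 Eb] := compact_bounded_by cE.
(* The midpoint leaves room on both sides: s below the dimension gives the measure, s above (d + k)
   / 2 gives a ratio below 1. *)
pose s := ((d%:R + k%:R) / 2 + hausdorff_dim E) / 2.
have s1 : (d%:R + k%:R) / 2 < s by rewrite /s; lra.
have s2 : s < hausdorff_dim E by rewrite /s; lra.
have s0 : 0 < s by apply: le_lt_trans s1; rewrite divr_ge0.
have [A0 [m0 [A00 fr]]] := frostman b0 s0 s2 Eb.
set q := 2 `^ (- s) in fr.
have q0 : 0 <= q by rewrite powR_ge0.
have rho1 : 2 ^+ (d + k) * q ^+ 2 < 1.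
  rewrite -!powR_mulrn ?powR_ge0// -powRrM -powRD; last by rewrite pnatr_eq0 implybT.
  rewrite -[X in _ < X](powRr0 2) /powR pnatr_eq0/= ltr_expR ltr_pM2r ?ln_gt0 ?ltr1n//.
  by rewrite natrD; lra.
pose kap := quantization_slack d.
have kap0 : (0 < kap)%N by rewrite /kap /quantization_slack; nia.
pose C := 8 ^+ k + 16 ^+ k * (9216 * kap ^ 2)%:R ^+ d * A0 ^+ 2 / (1 - 2 ^+ (d + k) * q ^+ 2).
have C0 : 0 <= C.
  by rewrite addr_ge0 ?exprn_ge0// divr_ge0 ?subr_ge0 ?(ltW rho1)// !mulr_ge0 ?exprn_ge0.
have half0 : 0 < 2^-1 :> R by rewrite invr_gt0.
have [eta eta0 small] := dist_prob_small sg deg C0 finset.setT half0.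
have twob0 : 0 < 2 * b by rewrite mulr_gt0.
(* With lam = 2 ^ m / (2 b), the box count 2 eps lam ^ |edges| becomes exactly eta (2 ^ m) ^
   |edges|, the size allowed by [small]. *)
pose eps := eta * (2 * b) ^+ #|edge_type e| / 2.
have eps0 : 0 < eps by rewrite divr_gt0// mulr_gt0// exprn_gt0.
have eps0E : (0 < eps%:E)%E by rewrite lte_fin.
have [_ [ab [ab1 abcov] <-] abeps] := ereal_inf_lt (le_lt_trans le0 eps0E).
pose w j (i : edge_type e) := (ab j).2 i - (ab j).1 i.
have w0 j i : 0 <= w j i by rewrite subr_ge0.
have rP j : exists r : R, 0 < r /\
    \prod_i (w j i + 3 * r) <= \prod_i w j i + eps / (2 ^ j.+1)%:R.
  have [K K0 HK] := prodr_addr_le (index_enum (edge_type e)) (w0 j).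
  have ej : 0 < eps / (2 ^ j.+1)%:R by rewrite divr_gt0// ltr0n expn_gt0.
  set ee := eps / _ in ej *.
  pose t := Num.min 1 (ee / (K + 1)).
  have t0 : 0 < t by rewrite lt_min ltr01/= divr_gt0// ltr_wpDl.
  have t1 : t <= 1 by rewrite ge_min lexx.
  exists (t / 3); split; first by rewrite divr_gt0.
  rewrite mulrC mulfVK//; apply: le_trans (HK t _) _; first by rewrite (ltW t0).
  rewrite lerD2l; apply: (@le_trans _ _ (t * (K + 1))).
    by rewrite ler_wpM2l ?(ltW t0)// lerDl.
  by rewrite -ler_pdivlMr ?ltr_wpDl// ge_min lexx orbT.
have [r {}rP] := choice rP.
have r0 j : 0 < r j by have [] := rP j.
have [J JP] := finite_box_cover cE r0 abcov.
(* The resolution is chosen only now, fine enough for the finitely many margins r j with j < J;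
   [eta] and [C] do not depend on it. *)
have [m [m0m mJ]] : exists m, (m0 <= m)%N /\
    forall j, (j < J)%N -> 2 <= (2 ^ m)%:R / (2 * b) * r j.
  have [f fP] := choice (fun j => ediam_cell_scale (mulr_gt0 twob0 (ltr0n R 2)) (r0 j)).
  exists (maxn m0 (\max_(j < J) f j)); split=> [|j jJ]; first exact: leq_maxl.
  set m := maxn _ _.
  have /fP : (f j <= m)%N.
    by rewrite leq_max; apply/orP; right; apply: (leq_bigmax (Ordinal jJ)).
  have p0 : 0 < (2 ^ m)%:R :> R by rewrite ltr0n expn_gt0.
  rewrite ler_pdivrMr// => H; rewrite mulrAC ler_pdivlMr//; lra.
have [mu [mu0 mu1 muE muA]] := fr m m0m.
have ptP (x : {ffun 'I_d -> 'I_(2 ^ m)}) : exists y : 'rV[R]_d,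
    mu x != 0 -> E y /\ dyadic_cell b m y = x.
  have [x0|x0] := eqVneq (mu x) 0; first by exists 0.
  by have [y Ey yx] := muE x x0; exists y.
have {ptP} [pt ptP] := choice ptP.
have ptb x : mu x != 0 -> bounded_by b (pt x) /\ dyadic_cell b m (pt x) = x.
  by move=> /ptP[/Eb].
pose lam := (2 ^ m)%:R / (2 * b).
have lam0 : 0 < lam := scale_gt0 b0 m.
pose tau := quantized_dist b pt.
have tauC x y : tau x y = tau y x by rewrite /tau /quantized_dist edistC.
have en (B : pred 'I_n) : (#|B| <= k)%N -> tau_energy mu tau B * (2 ^ m)%:R ^+ #|B| <= C.
  move=> Bk; apply: le_trans (energy_le_geometric kap0 mu0 mu1 muA A00 q0 Bk (fun=> erefl) rho1).
  by rewrite ler_wpM2r ?exprn_ge0// (tau_energy_le b0 mu0 ptb).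
pose ext (f : edge_type e -> R) p := if insub p is Some i then f i else 0.
(* Rounding down loses less than 1, whence the - 1; then hi - lo + 1 = lam (w + 2 r) + 2, the factor
   in [scale_cover_le]. *)
pose lo (j : 'I_J) p := lam * (ext (ab j).1 p - r j) - 1.
pose hi (j : 'I_J) p := lam * (ext (ab j).2 p + r j).
have lohi (j : 'I_J) p : 0 <= hi j p - lo j p + 1.
  have : ext (ab j).1 p <= ext (ab j).2 p by rewrite /ext; case: insubP.
  have := mJ j (ltn_ord j); have := r0 j; rewrite /lo /hi -/lam => r0j lr aleb.
  have : lam * ext (ab j).1 p <= lam * ext (ab j).2 p by rewrite ler_pM2l.
  by rewrite !mulrDr mulrN; lra.
have := card_family_le (d * 2 ^ m).+1 (edge_of e) lohi.
set N := [pred xi | _] => cardN.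
have Mpos : (0 < 2 ^ m)%N by rewrite expn_gt0.
have edges_inT p : edges_in e finset.setT p = edge_of e p.
  by rewrite /edges_in !finset.in_setT !andbT.
have edgesE : #|edges_in e finset.setT| = #|edge_type e|.
  by rewrite card_sig; apply: eq_card => p; exact: edges_inT.
have Nle : #|N|%:R <= eta * (2 ^ m)%:R ^+ #|edges_in e finset.setT|.
  apply: le_trans cardN _; rewrite edgesE.
  have -> : eta * (2 ^ m)%:R ^+ #|edge_type e| = lam ^+ #|edge_type e| * (eps *+ 2).
    have -> : eps *+ 2 = eta * (2 * b) ^+ #|edge_type e| by rewrite -[LHS]mulr_natr /eps mulfVK.
    rewrite /lam expr_div_n mulrCA mulfVK//.
    by rewrite expf_neq0// gt_eqF.
  apply: le_trans (scale_cover_le (v := fun j => \prod_i w j i) lam0 r0 mJ w0 _ eps0 _).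
  - apply: ler_sum => j _; rewrite prod_edges; apply: ler_prod => i _.
    rewrite lohi/= /hi /lo /ext valK /w; lra.
  - by move=> j; have [] := rP j.
  - move=> N'; rewrite -lee_fin; apply: le_trans (ltW abeps).
    rewrite -sumEFin -(big_mkord xpredT (fun j => (\prod_i w j i)%:E)).
    by apply: nneseries_lim_ge => j _ _; rewrite lee_fin prodr_ge0.
(* Every configuration of positive weight has its vector in N, since its representatives lie in E;
   so this probability is 1, not at most 1/2. *)
have := small _ _ mu tau (2 ^ m)%N Mpos mu0 mu1 tauC en N Nle.
rewrite /dist_prob (eq_bigr (fun x : {ffun 'I_n -> _} => \prod_v mu (x v))).
  by rewrite sum_prod_ffun// leNgt invf_lt1// ltr1n.
move=> x _; have [->|/prodf_neq0 xn0] := eqVneq (\prod_v mu (x v)) 0; first by rewrite mul0r.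
suff -> : N (dist_vector e tau finset.setT x) by rewrite mulr1.
have [j jJ jP] := JP (fun v => pt (x v)) (fun v => (ptP _ (xn0 v isT)).1).
apply/existsP; exists (Ordinal jJ); apply/forallP => p.
rewrite ffunE edges_inT; case: (boolP (edge_of e p)) => // ep.
have /andP[] := jP (Sub p ep); rewrite !SubK => j1 j2.
have /andP[t1 t2] := quantized_distP b0 ptb (xn0 p.1 isT) (xn0 p.2 isT).
rewrite /lo /hi /ext insubT/= -/lam -/tau in t1 t2 *.
have := ler_wpM2l (ltW lam0) j1; have := ler_wpM2l (ltW lam0) j2.
by move=> l1 l2; apply/andP; split; lra.
Qed.
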